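(* Let $(M,J)$ be an almost complex manifold, $\pi:TM\to M$ the projection and $\rho:M\to TM$ the zero section. There exists a canonical almost complex structure $\hat J$ on the total space $TM$ (namely the structure $\hat J$ defined in the context from a minimal connection, which does not depend on the choice of the minimal connection) such that: 1. The maps $\pi:TM\to M$ and $\rho:M\to TM$ are pseudoholomorphic. 2. $(TM,\hat J)$ is integrable if and only if $(M,J)$ is integrable.
   Context: The Nijenhuis tensor of $J$ is $N_J(X,Y)=[JX,JY]-J[JX,Y]-J[X,JY]-[X,Y]$; $J$ is integrable iff $N_J=0$. A map $f$ between almost complex manifolds is pseudoholomorphic if $df$ commutes with the almost complex structures. A linear connection $\nabla$ on $(M,J)$ is almost complex if $\nabla J=0$; an almost complex connection is minimal if its torsion is $T_\nabla=\frac14 N_J$. Minimal connections always exist (a known fact). Definition of $\hat J$: choose a minimal connection $\nabla$ on $M$. It gives a splitting $T_a(TM)=H_a\oplus V_a$ into horizontal and vertical components, $a\in TM$, with natural isomorphisms $\pi_*:H_a\simeq T_xM$ and $V_a\simeq T_xM$, $x=\pi(a)$. Put $\hat J=J\oplus J$ on $T_a(TM)$ with respect to this splitting and these isomorphisms. *)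

(* Defs.v *)
From HB Require Import structures.
From mathcomp Require Import all_boot all_order all_algebra.
From mathcomp Require Import all_classical reals topology normedtype landau derive.

Set Implicit Arguments.
Unset Strict Implicit.
Unset Printing Implicit Defensive.

Import Order.TTheory GRing.Theory Num.Theory.
Import numFieldNormedType.Exports.

Local Open Scope classical_set_scope.
Local Open Scope ring_scope.

Section smooth_functions.
Context {R : realType}.

(* Functions are total, but only their restriction to U matters; U is meant to
   be open, so that derivatives at points of U depend on that restriction only. *)
Fixpoint Ck {V W : normedModType R} (k : nat) (U : set V) (f : V -> W) : Prop :=
  if k is k'.+1 then
    (forall x, U x -> differentiable f x) /\
    (forall v, Ck k' U (fun x => 'D_v f x))
  else forall x, U x -> {for x, continuous f}.

Definition smooth_on {V W : normedModType R} (U : set V) (f : V -> W) : Prop :=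
  forall k, Ck k U f.

Section lemmas.
Context {V W : normedModType R}.
Implicit Types (U : set V) (f g : V -> W).

Lemma Ck_continuous k U f x : Ck k U f -> U x -> {for x, continuous f}.
Proof.
case: k => [|k] /=; first exact.
by move=> [df _] Ux; exact/differentiable_continuous/df.
Qed.

Lemma CkS k U f : Ck k.+1 U f -> Ck k U f.
Proof.
elim: k f => [|k IH] f [df Df]; first by move=> x /df /differentiable_continuous.
by split => // v; exact/IH/Df.
Qed.

Lemma Ck_subset k U U' f : U' `<=` U -> Ck k U f -> Ck k U' f.
Proof.
move=> UU'; elim: k f => [|k IH] f /=; first by move=> cf x /UU'; exact: cf.
by move=> [df Df]; split => [x /UU'|v]; [exact: df | exact/IH/Df].
Qed.

Lemma near_eq_differentiable f g x : (\near x, f x = g x) ->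
  differentiable f x -> differentiable g x.
Proof.
move=> fg df; have [Lc fE] := (diff_locallyP x f).1 df.
have gE : g \o shift x = cst (g x) + 'd f x +o_ 0 id.
  apply/eqaddoP => e e0.
  have fge : \forall h \near 0, f (h + x) = g (h + x).
    by move: fg; rewrite (near_shift 0); apply: filterS => h /=; rewrite subr0.
  have := (eqaddoP _ _ _ _).1 fE e e0.
  apply: filterS2 fge => h fgh /=.
  by rewrite -!fctE /= -[(_ - _) h]/(f (h + x) - (f x + 'd f x h)) fgh
     (nbhs_singleton fg).
have dgE := diff_unique Lc gE.
by apply/diff_locallyP; rewrite dgE.
Qed.

Lemma Ck_eq k U f g : open U -> (forall x, U x -> f x = g x) ->
  Ck k U f -> Ck k U g.
Proof.
move=> oU; elim: k f g => [|k IH] f g fg /=.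
  move=> cf x Ux; rewrite /prop_for /continuous_at -(fg x Ux).
  apply: cvg_trans (cf x Ux); apply: near_eq_cvg.
  by have := open_nbhs_nbhs (conj oU Ux); apply: filterS => y /fg ->.
have near_fg x : U x -> \near x, f x = g x.
  by move=> Ux; have := open_nbhs_nbhs (conj oU Ux); apply: filterS => y /fg ->.
move=> [df Df]; split => [x Ux|v].
  exact: near_eq_differentiable (near_fg _ Ux) (df _ Ux).
apply: (IH (fun x => 'D_v f x)) => // x Ux.
exact/near_eq_derive/near_fg.
Qed.

Lemma Ck_cst k U (a : W) : Ck k U (fun=> a).
Proof.
elim: k a => [|k IH] a /=; first by move=> x _; exact: cst_continuous.
split=> [x _|v]; first exact: differentiable_cst.
by under eq_fun do rewrite derive_cst.
Qed.

Lemma CkD k U f g : open U -> Ck k U f -> Ck k U g ->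
  Ck k U (fun x => f x + g x).
Proof.
move=> oU; elim: k f g => [|k IH] f g /=.
  by move=> cf cg x Ux; apply: continuousD; [exact: cf|exact: cg].
move=> [df Df] [dg Dg]; split => [x Ux|v].
  by apply: differentiableD; [exact: df|exact: dg].
apply: (@Ck_eq _ _ (fun x => 'D_v f x + 'D_v g x)) => //; last exact: IH.
move=> x Ux; rewrite -[LHS]deriveD //; apply: diff_derivable;
  [exact: df|exact: dg].
Qed.

Lemma Ck_sum k U I (r : seq I) (F : I -> V -> W) : open U ->
  (forall i, Ck k U (F i)) -> Ck k U (fun x => \sum_(i <- r) F i x).
Proof.
move=> oU CF; elim: r => [|i r IH].
  under eq_fun do rewrite big_nil; exact: Ck_cst.
by under eq_fun do rewrite big_cons; exact: CkD.
Qed.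

Lemma CkZl k U (f : V -> R) (a : W) : open U -> Ck k U f ->
  Ck k U (fun x => f x *: a).
Proof.
move=> oU; elim: k f => [|k IH] f /=.
  by move=> cf x Ux; apply: continuousZr_tmp; exact: cf.
move=> [df Df]; split => [x Ux|v]; first exact/differentiableZl/df.
apply: (@Ck_eq _ _ (fun x => 'D_v f x *: a)) => //; last exact: IH.
move=> x Ux; have dfx := df x Ux.
by rewrite (deriveE _ dfx) (deriveE _ (differentiableZl a dfx)) diffZl.
Qed.

End lemmas.

Section scalar_lemmas.
Context {V : normedModType R}.
Implicit Types U : set V.

Lemma CkM k U (f g : V -> R) : open U -> Ck k U f -> Ck k U g ->
  Ck k U (fun x => f x * g x).
Proof.
move=> oU; elim: k f g => [|k IH] f g /=.
  by move=> cf cg x Ux; apply: continuousM; [exact: cf|exact: cg].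
move=> fg1 fg2; have [df Df] := fg1; have [dg Dg] := fg2.
split => [x Ux|v]; first by apply: differentiableM; [exact: df|exact: dg].
apply: (@Ck_eq _ _ _ _ (fun x => f x * 'D_v g x + g x * 'D_v f x)) => //.
  move=> x Ux; rewrite -[RHS]/('D_v (f * g) x) deriveM //; apply: diff_derivable;
    [exact: df|exact: dg].
have [cf cg] := (CkS (conj df Df), CkS (conj dg Dg)).
by apply: (@CkD _ _ _ _ (fun x => f x * 'D_v g x) (fun x => g x * 'D_v f x)) => //;
  apply: IH.
Qed.

Lemma Ck_coord k m (U : set 'rV[R]_m) (j : 'I_m) :
  Ck k U (fun z : 'rV[R]_m => z 0 j : R).
Proof.
case: k => [|k]; first by move=> x _; exact: coord_continuous.
split=> [x _|v]; first exact: differentiable_coord.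
have -> : (fun x : 'rV[R]_m => 'D_v (fun z : 'rV[R]_m => z 0 j : R) x) =
    fun=> v 0 j.
  apply/funext => x; rewrite deriveE; last exact: differentiable_coord.
  pose f (z : 'rV[R]_m) : R := z 0 j.
  have lf : linear f by move=> a u w; rewrite /f !mxE.
  pose F : {linear 'rV[R]_m -> R} := HB.pack f (GRing.isLinear.Build _ _ _ _ _ lf).
  by rewrite -[LHS]/('d F x v) diff_lin //; exact: coord_continuous.
exact: Ck_cst.
Qed.

Lemma Ck_row k U m (f : V -> 'rV[R]_m) : open U ->
  (forall j, Ck k U (fun x => f x 0 j : R)) -> Ck k U f.
Proof.
move=> oU Cf; have -> : f = fun x => \sum_j (f x 0 j) *: delta_mx 0 j.
  by apply/funext => x; exact: row_sum_delta.
by apply: Ck_sum => // j; exact: CkZl.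
Qed.

Lemma Ck_row_coord k U m (f : V -> 'rV[R]_m) (j : 'I_m) : open U ->
  Ck k U f -> Ck k U (fun x => f x 0 j : R).
Proof.
move=> oU; elim: k f => [|k IH] f /=.
  move=> cf x Ux; apply: (@continuous_comp _ _ _ f (fun z : 'rV[R]_m => z 0 j)).
    exact: cf.
  exact: coord_continuous.
move=> [df Df]; split => [x Ux|v].
  apply: (@differentiable_comp _ _ _ _ f (fun z : 'rV[R]_m => z 0 j : R)).
    exact: df.
  exact: differentiable_coord.
apply: (@Ck_eq _ _ _ _ (fun x => ('D_v f x) 0 j : R)) => //; last exact: IH.
by move=> x Ux; rewrite derive_mx ?mxE //; apply/diff_derivable/df.
Qed.

Lemma Ck_comp_linear k (V' W : normedModType R) (L : {linear V' -> V}) U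
    (f : V -> W) :
  continuous L -> open U -> Ck k U f -> Ck k (L @^-1` U) (f \o L).
Proof.
move=> cL oU; have oLU : open (L @^-1` U) by apply: open_comp => // x _; exact: cL.
elim: k f => [|k IH] f /=.
  by move=> cf x Ux; apply: continuous_comp; [exact: cL|exact: cf].
move=> [df Df].
have dLx x : differentiable L x by exact: linear_differentiable.
split => [x Ux|v]; first by apply: differentiable_comp => //; exact: df.
apply: (@Ck_eq _ _ _ _ ((fun x => 'D_(L v) f x) \o L)) => //; last exact: IH.
move=> x Ux; have dfLx := df _ Ux.
rewrite /= (deriveE _ dfLx) (deriveE _ (differentiable_comp (dLx x) dfLx)).
by rewrite (diff_comp (dLx x) dfLx) /= (diff_lin x cL).
Qed.

End scalar_lemmas.
End smooth_functions.

Section manifold.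
Context {R : realType}.

(* A smooth (C^oo) n-dimensional manifold without boundary: a Hausdorff second
   countable space with a smooth atlas, not required to be maximal. [param i] is
   the inverse of [chart i]; both are total functions and carry information only
   on [dom i] and on its image. *)
Record manifold (n : nat) := Manifold {
  space :> topologicalType;
  chart_index : Type;
  dom : chart_index -> set space;
  chart : chart_index -> space -> 'rV[R]_n;
  param : chart_index -> 'rV[R]_n -> space;
  space_hausdorff : hausdorff_space space;
  space_second_countable : @second_countable space;
  dom_open : forall i, open (dom i);
  dom_cover : forall x, exists i, dom i x;
  chart_open : forall i, open (chart i @` dom i);
  chartK : forall i x, dom i x -> param i (chart i x) = x;
  chart_continuous : forall i x, dom i x -> {for x, continuous (chart i)};
  param_continuous : forall i y, (chart i @` dom i) y ->
    {for y, continuous (param i)};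
  transition_smooth : forall i j,
    smooth_on (chart i @` (dom i `&` dom j)) (chart j \o param i)
}.

Section tangent.
Context {n : nat} {M : manifold n}.
Implicit Types (x : M) (i j : chart_index M).

Definition cod i : set 'rV[R]_n := chart i @` dom i.

(* The tangent space T_x M is represented by 'rV_n: a row vector stands for the
   tangent vector whose components in the chart [chart_at x] are that row.
   [dchart i x] gives the components of a tangent vector at x in the chart i
   (i.e. it is T_x (chart i)), and [dparam i x] is its inverse. *)
Definition chart_at x : chart_index M := projT1 (cid (dom_cover x)).

Definition dchart i x : 'rV[R]_n -> 'rV[R]_n :=
  'd (chart i \o param (chart_at x)) (chart (chart_at x) x).

Definition dparam i x : 'rV[R]_n -> 'rV[R]_n :=
  'd (chart (chart_at x) \o param i) (chart i x).

Lemma chart_atP x : dom (chart_at x) x.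
Proof. exact: (projT2 (cid (dom_cover x))). Qed.

Lemma cod_dom i y : cod i y -> dom i (param i y).
Proof. by move=> [x dx <-]; rewrite chartK. Qed.

Lemma paramK i y : cod i y -> chart i (param i y) = y.
Proof. by move=> [x dx <-]; rewrite chartK. Qed.

Lemma dom_cod i x : dom i x -> cod i (chart i x).
Proof. by move=> dx; exists x. Qed.

Definition overlap i j : set 'rV[R]_n := chart i @` (dom i `&` dom j).

Lemma overlapE i j : overlap i j = cod i `&` param i @^-1` dom j.
Proof.
apply/seteqP; split => [y [x [xi xj] <-]|y [cy dy]].
  by split; [exists x | rewrite /= chartK].
by exists (param i y); [split => //; exact: cod_dom | exact: paramK].
Qed.

Lemma open_cod_param i (A : set M) : open A -> open (cod i `&` param i @^-1` A).
Proof.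
move=> oA; rewrite openE => y [cy Ay]; apply: filterI.
  by apply: open_nbhs_nbhs; split => //; exact: chart_open.
exact: (param_continuous cy (open_nbhs_nbhs (conj oA Ay))).
Qed.

Lemma overlap_open i j : open (overlap i j).
Proof. by rewrite overlapE; exact/open_cod_param/dom_open. Qed.

Lemma transition_differentiable i j y : overlap i j y ->
  differentiable (chart j \o param i) y.
Proof. by move=> oy; have [+ _] := @transition_smooth _ M i j 1; exact. Qed.

Lemma diff_transition_comp i j k y v : overlap i j y -> overlap i k y ->
  'd (chart k \o param j) (chart j (param i y)) ('d (chart j \o param i) y v) =
  'd (chart k \o param i) y v.
Proof.
rewrite !overlapE => -[cy yj] [_ yk].
have oj : overlap i j y by rewrite overlapE.
have ok : overlap i k y by rewrite overlapE.
have ojk : overlap j k (chart j (param i y)).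
  by rewrite overlapE; split; [exact: dom_cod|rewrite /= chartK].
have dij := transition_differentiable oj.
have djk := transition_differentiable ojk.
have dk := transition_differentiable ok.
transitivity ('d ((chart k \o param j) \o (chart j \o param i)) y v).
  exact: (esym (congr1 (fun h => h v) (diff_comp dij djk))).
apply: etrans (esym (deriveE v (differentiable_comp dij djk))) _.
apply: etrans _ (deriveE v dk); apply: near_eq_derive.
have := open_nbhs_nbhs (conj (@overlap_open i j) oj).
by apply: filterS => z; rewrite overlapE => -[cz zj] /=; rewrite chartK.
Qed.

Lemma diff_transition_id i y v : cod i y -> 'd (chart i \o param i) y v = v.
Proof.
move=> cy.
have oi : overlap i i y by rewrite overlapE; split => //; exact: cod_dom.
rewrite -deriveE; last exact: transition_differentiable.
rewrite (@near_eq_derive _ _ _ _ id) ?derive_id //.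
have := open_nbhs_nbhs (conj (@chart_open _ M i) cy).
by apply: filterS => z cz /=; exact: paramK.
Qed.

Lemma overlap_chart i j x : dom i x -> dom j x -> overlap i j (chart i x).
Proof. by move=> xi xj; exists x. Qed.

Lemma diff_transition_dom i j k x v : dom i x -> dom j x -> dom k x ->
  'd (chart k \o param j) (chart j x) ('d (chart j \o param i) (chart i x) v) =
  'd (chart k \o param i) (chart i x) v.
Proof.
move=> xi xj xk.
have := diff_transition_comp v (overlap_chart xi xj) (overlap_chart xi xk).
by rewrite chartK.
Qed.

Lemma dchartK i x v : dom i x -> dparam i x (dchart i x v) = v.
Proof.
move=> xi; have xc := chart_atP x.
apply: etrans (diff_transition_dom v xc xi xc) _.
exact/diff_transition_id/dom_cod.
Qed.

Lemma dparamK i x v : dom i x -> dchart i x (dparam i x v) = v.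
Proof.
move=> xi; have xc := chart_atP x.
apply: etrans (diff_transition_dom v xi xc xi) _.
exact/diff_transition_id/dom_cod.
Qed.

Lemma dchart_dparam i j x v : dom i x -> dom j x ->
  dchart j x (dparam i x v) = 'd (chart j \o param i) (chart i x) v.
Proof. by move=> xi xj; apply: diff_transition_dom => //; exact: chart_atP. Qed.

End tangent.

Record tangent_bundle n (M : manifold n) := TangentVector {
  base : M;
  vec : 'rV[R]_n
}.

HB.instance Definition _ n (M : manifold n) := gen_eqMixin (tangent_bundle M).
HB.instance Definition _ n (M : manifold n) :=
  gen_choiceMixin (tangent_bundle M).

Lemma rational_ball m (P : set 'rV[R]_m) (x : 'rV[R]_m) : open P -> P x ->
  exists (q : 'rV[rat]_m) (k : nat),
    ball (map_mx ratr q : 'rV[R]_m) k.+1%:R^-1 x /\ ball (map_mx ratr q : 'rV[R]_m) k.+1%:R^-1 `<=` P.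
Proof.
move=> oP Px; have := open_nbhs_nbhs (conj oP Px).
move=> /nbhs_ballP[e /= e0 eP].
have [k ke] : exists k, 0 + k.+1%:R^-1 < e / 2 by apply: ltr_add_invr; rewrite divr_gt0.
rewrite add0r in ke; pose d : R := k.+1%:R^-1.
have d0 : 0 < d by rewrite invr_gt0.
have xq j : exists q, `|ratr q - x 0 j| < d.
  have /rat_in_itvoo[q] : x 0 j - d < x 0 j + d by rewrite ltrBlDr -addrA ltrDl addr_gt0.
  by rewrite in_itv /= => q12; exists q; rewrite ltr_distl.
pose q : 'rV[rat]_m := \row_j projT1 (cid (xq j)).
have qx : ball (map_mx ratr q : 'rV[R]_m) d x.
  rewrite -ball_normE /= [ltLHS]mx_normrE bigmax_lt // => -[i j] _ /=.
  by rewrite !mxE ord1; exact: projT2 (cid (xq j)).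
exists q, k; split => // y qy; apply: eP.
apply: (@le_ball _ _ _ (d + d)); first by rewrite (splitr e) lerD // ltW.
by apply: ball_triangle qy; exact: ball_sym.
Qed.

Section tangent_manifold.
Context {n : nat} {M : manifold n}.
Implicit Types (i j : chart_index M) (a : tangent_bundle M)
  (z : 'rV[R]_(n + n)).

Definition tdom i : set (tangent_bundle M) := @base n M @^-1` dom i.

Definition tchart i a : 'rV[R]_(n + n) :=
  row_mx (chart i (base a)) (dchart i (base a) (vec a)).

Definition tparam i z : tangent_bundle M :=
  TangentVector (param i (lsubmx z))
    (dparam i (param i (lsubmx z)) (rsubmx z)).

(* The topology of TM for which the maps [tchart i] are homeomorphisms onto open
   subsets of R^(2n). *)
Definition topen (U : set (tangent_bundle M)) : Prop :=
  forall i, open [set z | cod i (lsubmx z) /\ U (tparam i z)].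

Lemma open_lsubmx (A : set 'rV[R]_n) : open A ->
  open [set z : 'rV[R]_(n + n) | A (lsubmx z)].
Proof.
by move=> oA; apply: open_comp => // z _; exact: continuous_lsubmx.
Qed.

Lemma topenT : topen setT.
Proof.
move=> i; rewrite (_ : [set z | _] = [set z | cod i (lsubmx z)]).
  exact/open_lsubmx/chart_open.
by apply/seteqP; split => [z []|z].
Qed.

Lemma topenI : setI_closed topen.
Proof.
move=> A B oA oB i.
rewrite (_ : [set z | _] = [set z | cod i (lsubmx z) /\ A (tparam i z)] `&`
  [set z | cod i (lsubmx z) /\ B (tparam i z)]); first exact: openI.
by apply/seteqP; split => [z [? []]|z [[? ?] [? ?]]].
Qed.

Lemma topen_bigU (I : Type) (f : I -> set (tangent_bundle M)) :
  (forall k, topen (f k)) -> topen (\bigcup_k f k).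
Proof.
move=> of_ i.
rewrite (_ : [set z | _] =
  \bigcup_k [set z | cod i (lsubmx z) /\ f k (tparam i z)]).
  by apply: bigcup_open => k _; exact: of_.
by apply/seteqP; split => [z [? [k _ ?]]|z [k _ [? ?]]]; [exists k|split=> //; exists k].
Qed.

HB.instance Definition _ :=
  @isOpenTopological.Build (tangent_bundle M) topen topenT topenI topen_bigU.

Lemma topenE (U : set (tangent_bundle M)) : open U = topen U.
Proof. by []. Qed.

Lemma tchartK i a : tdom i a -> tparam i (tchart i a) = a.
Proof.
case: a => x v xi; rewrite /tparam /tchart /= row_mxKl row_mxKr.
by rewrite chartK // dchartK.
Qed.

Lemma tparamK i z : cod i (lsubmx z) -> tchart i (tparam i z) = z.
Proof.
move=> cz; rewrite /tchart /tparam /= paramK // dparamK ?hsubmxK //.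
exact: cod_dom.
Qed.

Lemma tcodE i : tchart i @` tdom i = [set z | cod i (lsubmx z)].
Proof.
apply/seteqP; split => [z [a da <-]|z cz] /=.
  by rewrite row_mxKl; exact: dom_cod.
by exists (tparam i z); [exact: cod_dom | exact: tparamK].
Qed.

Lemma toverlapE i j : tchart i @` (tdom i `&` tdom j) =
  [set z | overlap i j (lsubmx z)].
Proof.
apply/seteqP; split => [z [a [ai aj] <-]|z] /=.
  by rewrite row_mxKl; exact: overlap_chart.
rewrite overlapE => -[cz zj]; exists (tparam i z); last exact: tparamK.
by split => //; exact: cod_dom.
Qed.

Lemma ttransitionE i j z : overlap i j (lsubmx z) ->
  tchart j (tparam i z) = row_mx ((chart j \o param i) (lsubmx z))
    (\sum_k (rsubmx z) 0 k *: 'D_(delta_mx 0 k) (chart j \o param i) (lsubmx z)).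
Proof.
move=> oz; have := oz; rewrite overlapE => -[cz zj].
rewrite /tchart /tparam /= dchart_dparam //; last exact: cod_dom.
rewrite paramK // [X in 'd _ _ X]row_sum_delta linear_sum; congr row_mx.
apply: eq_bigr => k _; rewrite linearZ /= deriveE //.
exact: transition_differentiable.
Qed.

Lemma ttransition_smooth i j :
  smooth_on (tchart i @` (tdom i `&` tdom j)) (tchart j \o tparam i).
Proof.
move=> k; rewrite toverlapE.
have oO : open [set z : 'rV[R]_(n + n) | overlap i j (lsubmx z)].
  exact/open_lsubmx/overlap_open.
have cl : continuous (lsubmx : 'rV[R]_(n + n) -> 'rV[R]_n).
  exact: continuous_lsubmx.
have Ct := @transition_smooth _ M i j.
apply: (Ck_eq oO (f := fun z => row_mx ((chart j \o param i) (lsubmx z))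
    (\sum_k (rsubmx z) 0 k *: 'D_(delta_mx 0 k) (chart j \o param i) (lsubmx z)))).
  by move=> z oz; rewrite -ttransitionE.
apply: Ck_row => // l; case: (split_ordP l) => m -> {l}.
  have := Ck_comp_linear cl (@overlap_open _ _ i j) (Ct k).
  move=> /(Ck_row_coord m oO); apply: (Ck_eq oO) => z _.
  by rewrite row_mxEl.
apply: (Ck_eq oO (f := fun z => \sum_p (z 0 (rshift n p) *
    ('D_(delta_mx 0 p) (chart j \o param i) (lsubmx z)) 0 m))).
  move=> z _; rewrite row_mxEr summxE; apply: eq_bigr => p _.
  by rewrite 2!mxE.
apply: Ck_sum => // p; apply: CkM => //; first exact: Ck_coord.
have [_ /(_ (delta_mx 0 p)) Dt] := Ct k.+1.
have := Ck_comp_linear cl (@overlap_open _ _ i j) Dt.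
by move=> /(Ck_row_coord m oO).
Qed.

Lemma tdom_open i : open (tdom i).
Proof.
rewrite topenE => j.
rewrite (_ : [set z | _] = [set z | overlap j i (lsubmx z)]).
  exact/open_lsubmx/overlap_open.
by rewrite overlapE.
Qed.

Lemma tchart_preimage_open i (O : set 'rV[R]_(n + n)) : open O ->
  open [set a | tdom i a /\ O (tchart i a)].
Proof.
move=> oO; rewrite topenE => j; rewrite openE => z [cz [zi Oz]].
have oz : overlap j i (lsubmx z) by rewrite overlapE.
have ct : {for z, continuous (tchart i \o tparam j)}.
  by apply: (@ttransition_smooth j i 0); rewrite toverlapE.
have n1 : nbhs z [set w | overlap j i (lsubmx w)].
  by apply: open_nbhs_nbhs; split => //; exact/open_lsubmx/overlap_open.
have n2 : nbhs z [set w | O (tchart i (tparam j w))].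
  exact: ct _ (open_nbhs_nbhs (conj oO Oz)).
apply: filterS2 n1 n2 => w; rewrite /= overlapE => -[cw wi] Ow.
by split.
Qed.

Lemma tchart_continuous i a : tdom i a -> {for a, continuous (tchart i)}.
Proof.
move=> ai A /=; rewrite nbhsE => -[P [oO Oa] OA].
have : open_nbhs a [set b | tdom i b /\ P (tchart i b)].
  by split; [exact: tchart_preimage_open|].
by move/open_nbhs_nbhs; apply: filterS => b [_ /OA].
Qed.

Lemma tparam_continuous i z : (tchart i @` tdom i) z ->
  {for z, continuous (tparam i)}.
Proof.
rewrite tcodE => cz A /=; rewrite nbhsE => -[P [oO Oa] OA].
have : open_nbhs z [set w | cod i (lsubmx w) /\ P (tparam i w)].
  by split; [exact: oO|].
by move/open_nbhs_nbhs; apply: filterS => w [_ /OA].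
Qed.

Lemma base_preimage_open (A : set M) : open A -> open (@base n M @^-1` A).
Proof.
move=> oA; rewrite topenE => j.
exact/(@open_lsubmx (cod j `&` param j @^-1` A))/open_cod_param.
Qed.

Lemma tangent_hausdorff : hausdorff_space (tangent_bundle M).
Proof.
rewrite open_hausdorff => a b ab.
have [bab|] := eqVneq (base a) (base b); last first.
  have := @space_hausdorff _ M; rewrite open_hausdorff => /[apply].
  move=> [[A B] /= [aA bB] [oA oB AB]].
  exists (@base n M @^-1` A, @base n M @^-1` B) => /=.
    by rewrite !inE /=; move: aA bB; rewrite !inE.
  split; [exact: base_preimage_open|exact: base_preimage_open|].
  by apply/eqP; rewrite -preimage_setI (eqP AB) preimage_set0.
set i := chart_at (base a).
have ai : tdom i a by exact: chart_atP.
have bi : tdom i b by rewrite /tdom /= -bab; exact: chart_atP.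
have cab : tchart i a != tchart i b.
  apply: contra_neq ab => cab.
  by rewrite -(tchartK ai) cab tchartK.
have := @norm_hausdorff R 'rV[R]_(n + n); rewrite open_hausdorff.
move=> /(_ _ _ cab) [[A B] /= [aA bB] [oA oB /eqP AB]].
exists ([set c | tdom i c /\ A (tchart i c)], [set c | tdom i c /\ B (tchart i c)]) => /=.
  by rewrite !inE /=; move: aA bB; rewrite !inE.
split; [exact: tchart_preimage_open|exact: tchart_preimage_open|].
apply/eqP/seteqP; split => // c [[_ Ac] [_ Bc]].
by have : (A `&` B) (tchart i c) by []; rewrite AB.
Qed.

Lemma tangent_second_countable : @second_countable (tangent_bundle M).
Proof.
have [B cB [oB basisB]] := @space_second_countable _ M.
pose F (p : set M * ('rV[rat]_(n + n) * nat)) : set (tangent_bundle M) :=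
  [set a | exists h : exists i, p.1 `<=` dom i,
    p.1 (base a) /\
    ball (map_mx ratr p.2.1 : 'rV[R]_(n + n)) p.2.2.+1%:R^-1 (tchart (projT1 (cid h)) a)].
exists (F @` (B `*` setT)).
  apply: (@sub_countable _ _ _ (B `*` setT)); first exact: card_image_le.
  by apply: countableX => //; exact: countableP.
split.
  move=> _ [[b [q k]] [/= Bb _] <-].
  have [h|nh] := pselect (exists i, b `<=` dom i); last first.
    rewrite (_ : F _ = set0); first exact: open0.
    by apply/seteqP; split => // a [h].
  rewrite (_ : F _ = (@base n M @^-1` b) `&` [set a | tdom (projT1 (cid h)) a /\
      ball (map_mx ratr q : 'rV[R]_(n + n)) k.+1%:R^-1 (tchart (projT1 (cid h)) a)]).
    apply: openI; first exact/base_preimage_open/oB.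
    by apply: tchart_preimage_open; exact: ball_open.
  apply/seteqP; split => a.
    move=> [h' /= [ba]]; rewrite (Prop_irrelevance h' h) => ?; split => //=.
    by split => //; exact: (projT2 (cid h)).
  by move=> [/= ba [_ ?]]; exists h.
move=> a A; rewrite nbhsE => -[P [oP Pa] PA].
have [i ai] := dom_cover (base a).
have [b [Bb ba] bi] := basisB _ _ (open_nbhs_nbhs (conj (@dom_open _ M i) ai)).
have h : exists i, b `<=` dom i by exists i.
set c := projT1 (cid h).
have bc : b `<=` dom c := projT2 (cid h).
have ac : dom c (base a) := bc _ ba.
have oPc := oP c.
have Pca : [set z | cod c (lsubmx z) /\ P (tparam c z)] (tchart c a).
  by split; [rewrite row_mxKl; exact: dom_cod|rewrite tchartK].
have [q [k [qka qkP]]] := rational_ball oPc Pca.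
exists (F (b, (q, k))).
  by split; [exists (b, (q, k))|exists h].
move=> a' [h' /= [ba']]; rewrite (Prop_irrelevance h' h) -/c => /qkP[_].
by rewrite tchartK; [exact: PA|exact: bc].
Qed.

Lemma tdom_cover a : exists i, tdom i a.
Proof. exact: dom_cover. Qed.

Lemma tchart_open i : open (tchart i @` tdom i).
Proof. by rewrite tcodE; exact/open_lsubmx/chart_open. Qed.

End tangent_manifold.
End manifold.

Arguments manifold R n : clear implicits.

Section almost_complex.
Context {R : realType}.

Section maps.
Context {m n : nat} {M : manifold R m} {N : manifold R n}.

Definition smooth_map (f : M -> N) : Prop :=
  continuous f /\
  forall i j, smooth_on (chart i @` (dom i `&` f @^-1` dom j))
                        (chart j \o f \o param i).

(* The differential T_x M -> T_(f x) N, in the preferred charts at x and f x. *)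
Definition tangent_map (f : M -> N) (x : M) : 'rV[R]_m -> 'rV[R]_n :=
  'd (chart (chart_at (f x)) \o f \o param (chart_at x))
     (chart (chart_at x) x).

End maps.

Record almost_complex_structure n (M : manifold R n) := AlmostComplexStructure {
  acs :> M -> {linear 'rV[R]_n -> 'rV[R]_n};
  acs_square : forall x v, acs x (acs x v) = - v;
  acs_smooth : forall i w, smooth_on (cod i) (fun y =>
    dchart i (param i y) (acs (param i y) (dparam i (param i y) w)))
}.

Definition pseudoholomorphic m n (M : manifold R m) (N : manifold R n)
    (J : almost_complex_structure M) (J' : almost_complex_structure N)
    (f : M -> N) : Prop :=
  smooth_map f /\
  forall x v, tangent_map f x (J x v) = J' (f x) (tangent_map f x v).

Section fields.
Context {n : nat} {M : manifold R n}.
Implicit Types (X Y : M -> 'rV[R]_n) (x : M) (f : M -> R).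

Definition local_field i X : 'rV[R]_n -> 'rV[R]_n :=
  fun y => dchart i (param i y) (X (param i y)).

Definition smooth_field X : Prop :=
  forall i, smooth_on (cod i) (local_field i X).

Definition smooth_function f : Prop :=
  forall i, smooth_on (cod i) (f \o param i : 'rV[R]_n -> R).

Definition field_derive X f x : R :=
  'D_(X x) (f \o param (chart_at x) : 'rV[R]_n -> R) (chart (chart_at x) x).

(* [X, Y] = DY(X) - DX(Y) in the preferred chart at x, in which the components
   of the tangent vector X x are X x itself. *)
Definition lie_bracket X Y x : 'rV[R]_n :=
  'D_(X x) (local_field (chart_at x) Y) (chart (chart_at x) x) -
  'D_(Y x) (local_field (chart_at x) X) (chart (chart_at x) x).

Definition acs_field (J : almost_complex_structure M) X : M -> 'rV[R]_n :=
  fun x => J x (X x).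

Definition nijenhuis (J : almost_complex_structure M) X Y x : 'rV[R]_n :=
  lie_bracket (acs_field J X) (acs_field J Y) x
  - J x (lie_bracket (acs_field J X) Y x)
  - J x (lie_bracket X (acs_field J Y) x)
  - lie_bracket X Y x.

Definition integrable (J : almost_complex_structure M) : Prop :=
  forall X Y, smooth_field X -> smooth_field Y -> forall x, nijenhuis J X Y x = 0.

(* A connection acts on smooth vector fields; the values of [nabla] on non-smooth
   arguments are unconstrained and never used. *)
Record linear_connection := LinearConnection {
  nabla :> (M -> 'rV[R]_n) -> (M -> 'rV[R]_n) -> M -> 'rV[R]_n;
  nabla_smooth : forall X Y, smooth_field X -> smooth_field Y ->
    smooth_field (nabla X Y);
  nablaDl : forall X X' Y,
    smooth_field X -> smooth_field X' -> smooth_field Y ->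
    forall x, nabla (fun x => X x + X' x) Y x = nabla X Y x + nabla X' Y x;
  nablaZl : forall f X Y,
    smooth_function f -> smooth_field X -> smooth_field Y ->
    forall x, nabla (fun x => f x *: X x) Y x = f x *: nabla X Y x;
  nablaDr : forall X Y Y',
    smooth_field X -> smooth_field Y -> smooth_field Y' ->
    forall x, nabla X (fun x => Y x + Y' x) x = nabla X Y x + nabla X Y' x;
  nabla_leibniz : forall f X Y,
    smooth_function f -> smooth_field X -> smooth_field Y ->
    forall x, nabla X (fun x => f x *: Y x) x =
              field_derive X f x *: Y x + f x *: nabla X Y x
}.

Definition torsion (D : linear_connection) X Y x : 'rV[R]_n :=
  D X Y x - D Y X x - lie_bracket X Y x.

Definition almost_complex_connection (J : almost_complex_structure M)
    (D : linear_connection) : Prop :=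
  forall X Y, smooth_field X -> smooth_field Y ->
  forall x, D X (acs_field J Y) x = J x (D X Y x).

Definition minimal_connection (J : almost_complex_structure M)
    (D : linear_connection) : Prop :=
  almost_complex_connection J D /\
  forall X Y, smooth_field X -> smooth_field Y ->
  forall x, torsion D X Y x = 4^-1 *: nijenhuis J X Y x.

End fields.

Section tangent_bundle_structure.
Context {n : nat} {M : manifold R n}.

Definition tangent_manifold : manifold R (n + n) :=
  Manifold (@tangent_hausdorff R n M) tangent_second_countable
    tdom_open tdom_cover tchart_open tchartK tchart_continuous
    tparam_continuous ttransition_smooth.

Definition bundle_projection : tangent_manifold -> M := @base R n M.

Definition zero_section : M -> tangent_manifold :=
  fun x => TangentVector x 0.

Definition field_section (Y : M -> 'rV[R]_n) : M -> tangent_manifold :=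
  fun x => TangentVector x (Y x).

(* The velocity at t = 0 of the curve t |-> a + t u in the fibre of a; this is the
   natural isomorphism from T_x M onto V_a. *)
Definition vertical_lift (a : tangent_manifold) (u : 'rV[R]_n) :
    'rV[R]_(n + n) :=
  derive1 (fun t : R => chart (chart_at a)
     (TangentVector (base a) (vec a + t *: u) : tangent_manifold)) 0.

(* H_a consists of the vectors dY(w) - (nabla_w Y)^vert at a, for the vector
   fields Y with Y(x) = a and w in T_x M; equivalently, of the velocities at a of
   the nabla-parallel vector fields along the curves through x. *)
Definition horizontal_space (D : @linear_connection n M)
    (a : tangent_manifold) : set 'rV[R]_(n + n) :=
  [set h | exists X Y, [/\ smooth_field X, smooth_field Y,
     Y (base a) = vec a &
     h = tangent_map (field_section Y) (base a) (X (base a))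
         - vertical_lift a (D X Y (base a))]].

Definition vertical_space (a : tangent_manifold) : set 'rV[R]_(n + n) :=
  range (vertical_lift a).

(* Jh = J (+) J in the splitting T_a(TM) = H_a (+) V_a, with H_a identified to
   T_x M by the differential of the projection and V_a by [vertical_lift]. *)
Definition induced_structure (J : almost_complex_structure M)
    (D : linear_connection)
    (Jh : almost_complex_structure tangent_manifold) : Prop :=
  forall a : tangent_manifold,
  [/\ forall xi, exists h v, [/\ horizontal_space D a h, vertical_space a v
                               & xi = h + v],
      forall h, horizontal_space D a h ->
        horizontal_space D a (Jh a h) /\
        tangent_map bundle_projection a (Jh a h) =
          J (base a) (tangent_map bundle_projection a h)
    & forall u, Jh a (vertical_lift a u) = vertical_lift a (J (base a) u)].

End tangent_bundle_structure.
End almost_complex.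

Arguments tangent_manifold {R n} M.
Arguments zero_section {R n} M.
Arguments bundle_projection {R n} M.

(* Main.v *)
(* A minimal connection comes from a torsion free one by the explicit correction
   D - Q of Kobayashi and Nomizu, and torsion free connections are glued from the
   flat connections of the charts.

   In a chart, let A be the matrix of J, (D_v A) w its derivative and N its
   Nijenhuis tensor. The relations between a minimal connection, the bracket and
   N give, at the tangent vector v, in coordinates,
     Jh (w, u) = (A w, A u + (D_v A) w + A N(w, v) / 2),
   in which no connection is left. So Jh is defined by this formula; it does not
   depend on the chart because second derivatives of the transition maps are
   symmetric. The horizontal part of the Nijenhuis tensor of Jh is N. Conversely,
   if N = 0 then Jh is the complete lift of J and the vertical part of its
   Nijenhuis tensor at v is the derivative of N in the direction of v and of the
   vertical components of its arguments, hence 0. *)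

Require Import Defs.
From HB Require Import structures.
From mathcomp Require Import all_boot all_order all_algebra.
From mathcomp Require Import all_classical reals topology normedtype derive.
From mathcomp Require Import sequences exp.
From mathcomp Require Import ring lra.

Set Implicit Arguments.
Unset Strict Implicit.
Unset Printing Implicit Defensive.

Import Order.TTheory GRing.Theory Num.Theory.
Import numFieldNormedType.Exports.

Local Open Scope classical_set_scope.
Local Open Scope ring_scope.

(** * Differential calculus *)

(** The half in front of A N(w, v) is the sum of two quarters. Write G(w, v) for the covariant
    derivative, in a chart, of the constant field v along w. The horizontal lift of w at v is (w, -
    G(w, v)), so the correction to be found is A G(w, v) - G(Aw, v). The torsion condition exchanges
    the arguments of both G's at the cost of A N(w, v) / 4 and - N(Aw, v) / 4, which are equal
    because N(Aw, v) = - A N(w, v); then nabla J = 0 evaluates A G(v, w) - G(v, Aw) as (D_v A) w.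
    Connections, horizontal vectors and integrability are expressed through global smooth fields,
    while the computations take place at one point of one chart. Cutoff functions bridge this gap:
    they extend a tangent vector to a global field and supply the weights that glue connections.
    Chart expressions are total functions with a meaning on open sets only, so linearity, smoothness
    and A^2 = -1 are carried as hypotheses restricted to such a set. *)

Section calculus.
Context {R : realType}.

Lemma derive_dirP {V W : normedModType R} (f : V -> W) x u v (a : R) :
  differentiable f x -> 'D_(a *: u + v) f x = a *: 'D_u f x + 'D_v f x.
Proof. by move=> df; rewrite !deriveE // linearP. Qed.

Lemma derive_chain {V W Z : normedModType R} (f : V -> W) (g : W -> Z) x v :
  differentiable f x -> differentiable g (f x) ->
  'D_v (fun y => g (f y)) x = 'D_('D_v f x) g (f x).
Proof.
move=> df dg; rewrite (deriveE _ (differentiable_comp df dg)) diff_comp //=.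
by rewrite (deriveE _ dg) (deriveE _ df).
Qed.

Lemma derive_line {V W : normedModType R} (f : V -> W) x v (s : R) :
  differentiable f (x + s *: v) ->
  is_derive s 1 (fun t : R => f (x + t *: v)) ('D_v f (x + s *: v)).
Proof.
move=> df; pose l (t : R) : V := x + t *: v.
have dz : differentiable (fun t : R => t *: v) s.
  exact: (@differentiableZl _ _ _ id).
have dl : differentiable l s by exact: differentiableD.
have -> : (fun t : R => f (x + t *: v)) = f \o l by [].
have dfl : differentiable (f \o l) s by exact: differentiable_comp.
apply: DeriveDef; first exact: diff_derivable.
rewrite derive_chain //; congr (derive _ _ _).
have -> : 'D_1 l s = 'D_1 (cst x) s + 'D_1 (fun t : R => t *: v) s.
  by apply: deriveD; exact: diff_derivable.
by rewrite derive_cst add0r deriveE // (@diffZl _ _ _ id) // diff_val scale1r.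
Qed.

Lemma derive_eq_on {V W : normedModType R} (U : set V) (f g : V -> W) x v :
  open U -> (forall y, U y -> f y = g y) -> U x -> 'D_v f x = 'D_v g x.
Proof.
move=> oU fg Ux; apply: near_eq_derive.
by have := open_nbhs_nbhs (conj oU Ux); apply: filterS => y /fg ->.
Qed.

(** Allows a function to be given by different formulas on different open sets, as for a cutoff
    extended by zero. *)
Lemma Ck_local {V W : normedModType R} k (U : set V) (f : V -> W) :
  (forall x, U x -> exists U', [/\ open U', U' x & Ck k U' f]) -> Ck k U f.
Proof.
elim: k f => [|k IH] f Uf /=.
  by move=> x /Uf [U' [_ U'x]]; exact.
split => [x /Uf [U' [_ U'x [df _]]]|v]; first exact: df.
by apply: IH => x /Uf [U' [oU' U'x [_ Df]]]; exists U'; split=> //; exact: Df.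
Qed.

Lemma smooth_differentiable {V W : normedModType R} (U : set V) (f : V -> W) x :
  smooth_on U f -> U x -> differentiable f x.
Proof. by move=> /(_ 1%N) [+ _]; exact. Qed.

Lemma smooth_derive {V W : normedModType R} (U : set V) (f : V -> W) v :
  smooth_on U f -> smooth_on U (fun x => 'D_v f x).
Proof. by move=> sf k; have [_] := sf k.+1; exact. Qed.

Lemma CkZ {V : normedModType R} k m (U : set V) (f : V -> R)
    (g : V -> 'rV[R]_m) : open U ->
  Ck k U f -> Ck k U g -> Ck k U (fun x => f x *: g x).
Proof.
move=> oU Cf Cg; apply: Ck_row => // j; under eq_fun do rewrite mxE.
by apply: CkM => //; exact: Ck_row_coord.
Qed.

Lemma CkN {V W : normedModType R} k (U : set V) (f : V -> W) : open U ->
  Ck k U f -> Ck k U (fun x => - f x).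
Proof.
move=> oU; elim: k f => [|k IH] f /=.
  by move=> cf x Ux; apply: continuousN; exact: cf.
move=> [df Df]; split => [x Ux|v]; first exact/differentiableN/df.
apply: (@Ck_eq _ _ _ _ _ (fun x => - 'D_v f x)) => //; last exact: IH.
by move=> x Ux; rewrite -(deriveN (diff_derivable (df x Ux))).
Qed.

Lemma CkB {V W : normedModType R} k (U : set V) (f g : V -> W) : open U ->
  Ck k U f -> Ck k U g -> Ck k U (fun x => f x - g x).
Proof. by move=> oU Cf Cg; apply: CkD => //; exact: CkN. Qed.

(** By the chain rule a derivative of the composite is a sum of products of coordinates of the
    derivative of [f] with partial derivatives of [g] taken at [f x]. For real-valued [g] these are
    plain products, and the partial derivatives are again covered by the induction. *)
Lemma Ck_compR {V : normedModType R} k m (U : set V) (U' : set 'rV[R]_m)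
    (f : V -> 'rV[R]_m) (g : 'rV[R]_m -> R) :
  open U -> open U' -> (forall x, U x -> U' (f x)) ->
  Ck k U f -> Ck k U' g -> Ck k U (fun x => g (f x)).
Proof.
move=> oU oU' fU; elim: k g => [|k IH] g.
  move=> cf cg x Ux; apply: (@continuous_comp _ _ _ f g); first exact: cf.
  exact/cg/fU.
move=> Cf Cg; have [df Df] := Cf; have [dg Dg] := Cg.
split => [x Ux|v].
  by apply: (@differentiable_comp _ _ _ _ f g); [exact: df|exact/dg/fU].
apply: (@Ck_eq _ _ _ _ _ (fun x => \sum_j ('D_v f x) 0 j *
    'D_(delta_mx 0 j) g (f x))) => //.
  move=> x Ux; have dgx := dg _ (fU _ Ux).
  rewrite (derive_chain (f := f) (g := g)) //; last exact: df.
  rewrite (deriveE _ dgx) [in RHS](row_sum_delta ('D_v f x)) linear_sum.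
  by apply: eq_bigr => j _; rewrite linearZ /= (deriveE _ dgx).
apply: Ck_sum => // j; apply: CkM => //.
  by apply: Ck_row_coord => //; exact: Df.
by apply: (IH (fun y => 'D_(delta_mx 0 j) g y)); [exact: CkS|exact: Dg].
Qed.

Lemma Ck_comp {V : normedModType R} k m p (U : set V) (U' : set 'rV[R]_m)
    (f : V -> 'rV[R]_m) (g : 'rV[R]_m -> 'rV[R]_p) :
  open U -> open U' -> (forall x, U x -> U' (f x)) ->
  Ck k U f -> Ck k U' g -> Ck k U (fun x => g (f x)).
Proof.
move=> oU oU' fU Cf Cg; apply: Ck_row => // j.
by apply: (Ck_compR (g := fun y => g y 0 j) oU oU') => //; exact: Ck_row_coord.
Qed.

Lemma rV_linearE m (W : normedModType R) (f : 'rV[R]_m -> W) w : linear f ->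
  f w = \sum_j w 0 j *: f (delta_mx 0 j).
Proof.
move=> lf; pose F : {linear 'rV[R]_m -> W} :=
  HB.pack f (GRing.isLinear.Build _ _ _ _ _ lf).
rewrite -[f]/(F : _ -> _) {1}(row_sum_delta w) linear_sum.
by apply: eq_bigr => j _; rewrite linearZ.
Qed.

(** Expanding [f x] in the standard basis leaves finitely many functions [B x (delta_mx 0 j)] with
    scalar coefficients, so fixed vectors suffice. Applied both to structures, [A y (f y)], and to
    derivatives along a variable direction. *)
Lemma Ck_pairing {V : normedModType R} k m p (U : set V)
    (B : V -> 'rV[R]_m -> 'rV[R]_p) (f : V -> 'rV[R]_m) : open U ->
  (forall x, U x -> linear (B x)) -> (forall w, Ck k U (B ^~ w)) ->
  Ck k U f -> Ck k U (fun x => B x (f x)).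
Proof.
move=> oU lB CB Cf.
apply: (@Ck_eq _ _ _ _ _ (fun x => \sum_j f x 0 j *: B x (delta_mx 0 j))) => //.
  by move=> x Ux; rewrite [RHS]rV_linearE //; exact: lB.
by apply: Ck_sum => // j; apply: CkZ => //; exact: Ck_row_coord.
Qed.

Lemma deriveZv {V : normedModType R} m (f : V -> R) (g : V -> 'rV[R]_m) x v :
  differentiable f x -> differentiable g x ->
  'D_v (fun y => f y *: g y) x = 'D_v f x *: g x + f x *: 'D_v g x.
Proof.
move=> df dg; have dgj j : differentiable (fun y => g y 0 j : R) x.
  by apply: (@differentiable_comp _ _ _ _ g (fun z : 'rV[R]_m => z 0 j : R)) => //;
    exact: differentiable_coord.
have gv : derivable g x v by exact: diff_derivable.
have fv : derivable f x v by exact: diff_derivable.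
have gjv j : derivable (fun y => g y 0 j : R) x v by exact: diff_derivable.
have E j : (fun y => (f y *: g y) 0 j) = f * (fun y => g y 0 j).
  by apply/funext => y; rewrite mxE.
apply/rowP => j; rewrite derive_mx; last first.
  by apply/derivable_mxP => i' j' /=; rewrite ord1 E; exact: derivableM fv (gjv j').
rewrite !mxE E (deriveM fv (gjv j)) (derive_mx gv) !mxE addrC.
by congr (_ + _); exact: mulrC.
Qed.

(** The product rule for evaluating a field of linear maps on a field of vectors, by the same
    expansion in the standard basis. *)
Lemma derive_pairing {V : normedModType R} m p (U : set V)
    (B : V -> 'rV[R]_m -> 'rV[R]_p) (f : V -> 'rV[R]_m) x v : open U -> U x ->
  (forall x, U x -> linear (B x)) -> (forall w, Ck 1 U (B ^~ w)) ->
  Ck 1 U f ->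
  'D_v (fun y => B y (f y)) x = 'D_v (B ^~ (f x)) x + B x ('D_v f x).
Proof.
move=> oU Ux lB CB Cf.
have Cfj j : Ck 1 U (fun y => f y 0 j : R) by exact: Ck_row_coord.
have CfB j : Ck 1 U (fun y => f y 0 j *: B y (delta_mx 0 j)) by exact: CkZ.
have CcB j : Ck 1 U (fun y => f x 0 j *: B y (delta_mx 0 j)).
  by apply: CkZ => //; exact: Ck_cst.
have d1 (W : normedModType R) (g : V -> W) : Ck 1 U g -> differentiable g x.
  by case=> + _; exact.
have dsum (g : 'I_m -> V -> 'rV[R]_p) : (forall j, Ck 1 U (g j)) ->
    'D_v (fun y => \sum_j g j y) x = \sum_j 'D_v (g j) x.
  move=> Cg; have -> : (fun y => \sum_j g j y) = \sum_j g j.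
    exact/esym/fct_sumE.
  by apply: derive_sum => j; apply: diff_derivable; exact: d1 (Cg j).
rewrite (@derive_eq_on _ _ U _ (fun y => \sum_j f y 0 j *: B y (delta_mx 0 j))) //;
  last by move=> y Uy; rewrite [LHS]rV_linearE //; exact: lB.
rewrite (@derive_eq_on _ _ U (B ^~ (f x))
  (fun y => \sum_j f x 0 j *: B y (delta_mx 0 j))) //;
  last by move=> y Uy; rewrite [LHS]rV_linearE //; exact: lB.
rewrite [X in _ = _ + X]rV_linearE; last exact: lB.
rewrite (dsum _ CfB) (dsum _ CcB) -big_split; apply: eq_bigr => j _.
have [df dfj dBj] := And3 (d1 _ _ Cf) (d1 _ _ (Cfj j)) (d1 _ _ (CB (delta_mx 0 j))).
have fv : derivable f x v by exact: diff_derivable.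
have Bv : derivable (B ^~ (delta_mx 0 j)) x v by exact: diff_derivable.
rewrite (deriveZv v dfj dBj) addrC; congr (_ + _ *: _); last first.
  by rewrite (derive_mx fv) mxE.
exact/esym/deriveZ.
Qed.

(** * Symmetry of second derivatives *)

Section second_difference.
Context {V : normedModType R}.

(* Both iterated differences equal the second difference of [f] over the
   parallelogram, so by the mean value theorem the two mixed derivatives take a
   common value at points arbitrarily close to [x]. *)
Lemma second_difference (f : V -> R) (x v w : V) (P : set V) (d : R) : 0 <= d ->
  (forall s t, 0 <= s <= d -> 0 <= t <= d -> P (x + s *: v + t *: w)) ->
  (forall y, P y -> differentiable f y) ->
  (forall y, P y -> differentiable (fun z => 'D_v f z) y) ->
  exists y, P y /\
    f (x + d *: v + d *: w) - f (x + d *: v) - (f (x + d *: w) - f x) =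
    'D_w (fun z => 'D_v f z) y * d * d.
Proof.
move=> d0 Pst df dDf.
have dd : 0 <= d <= d by rewrite d0 lexx.
have d00 : 0 <= (0 : R) <= d by rewrite lexx.
have P0 s : 0 <= s <= d -> P (x + s *: v).
  by move=> sd; have := Pst s 0 sd d00; rewrite scale0r addr0.
pose F s := f (x + d *: w + s *: v) - f (x + s *: v).
have dF (s : R) : 0 <= s <= d -> is_derive s 1 F
    ('D_v f (x + d *: w + s *: v) - 'D_v f (x + s *: v)).
  move=> sd; apply: is_deriveB; apply: derive_line; apply: df; last exact: P0.
  by rewrite addrAC; exact: Pst.
have [s] : exists2 s, s \in `[0, d] & F d - F 0 =
    ('D_v f (x + d *: w + s *: v) - 'D_v f (x + s *: v)) * (d - 0).
  apply: (MVT_segment d0) => [s|].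
    by rewrite in_itv /= => /andP[/ltW s0 /ltW sd]; apply: dF; rewrite s0.
  apply: derivable_within_continuous => s; rewrite in_itv /= => sd.
  by have [] := dF _ sd.
rewrite in_itv /= => sd FE.
pose G t := 'D_v f (x + s *: v + t *: w).
have dG (t : R) : 0 <= t <= d -> is_derive t 1 G
    ('D_w (fun z => 'D_v f z) (x + s *: v + t *: w)).
  move=> td; apply: (derive_line (f := fun z => 'D_v f z)).
  exact/dDf/Pst.
have [t] : exists2 t, t \in `[0, d] & G d - G 0 =
    ('D_w (fun z => 'D_v f z) (x + s *: v + t *: w)) * (d - 0).
  apply: (MVT_segment d0) => [t|].
    by rewrite in_itv /= => /andP[/ltW t0 /ltW td]; apply: dG; rewrite t0.
  apply: derivable_within_continuous => t; rewrite in_itv /= => td.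
  by have [] := dG _ td.
rewrite in_itv /= => td GE.
exists (x + s *: v + t *: w); split; first exact: Pst.
move: FE GE; rewrite /F /G !subr0 !scale0r !addr0 => FE GE.
rewrite -GE -[x + s *: v + _]addrAC -FE.
by rewrite -[x + d *: v + _]addrAC opprB addrA [_ + f x]addrC; lra.
Qed.

Lemma derive_sym_scalar (U : set V) (f : V -> R) x v w : open U -> U x ->
  Ck 2 U f -> 'D_v (fun y => 'D_w f y) x = 'D_w (fun y => 'D_v f y) x.
Proof.
have close (p q u e : R) : `|p - q| < e / 2 -> `|u - q| < e / 2 -> `|p - u| <= e.
  move=> pq uq; apply: le_trans (ler_distD q _ _) _; rewrite (splitr e).
  by apply: lerD; apply: ltW => //; rewrite distrC.
move=> oU Ux [df Df]; apply/eqP; rewrite -subr_eq0 -normr_eq0; apply/eqP.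
apply/le_anti; rewrite normr_ge0 andbT; apply/ler_addgt0Pr => e e0; rewrite add0r.
have cvw : {for x, continuous (fun y => 'D_v (fun z => 'D_w f z) y)}.
  exact: (Df w).2 v x Ux.
have cwv : {for x, continuous (fun y => 'D_w (fun z => 'D_v f z) y)}.
  exact: (Df v).2 w x Ux.
have e2 : 0 < e / 2 by rewrite divr_gt0.
pose fvw y := 'D_v (fun z => 'D_w f z) y; pose fwv y := 'D_w (fun z => 'D_v f z) y.
have n1 : nbhs x [set y | ball (fvw x) (e / 2) (fvw y)].
  exact: cvw _ (nbhsx_ballx _ _ e2).
have n2 : nbhs x [set y | ball (fwv x) (e / 2) (fwv y)].
  exact: cwv _ (nbhsx_ballx _ _ e2).
have n3 : nbhs x U by exact: open_nbhs_nbhs.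
have n123 : nbhs x ([set y | ball (fvw x) (e / 2) (fvw y)] `&`
  ([set y | ball (fwv x) (e / 2) (fwv y)] `&` U)).
  by apply: filterI => //; exact: filterI.
have [r /= r0 rP] := (nbhs_ballP _ _).1 n123.
(* With d = r / (2 c) the parallelogram with sides [d *: v] and [d *: w] stays within distance r / 2
   of [x]; the summand 1 keeps [c] positive when both vectors vanish. *)
pose c := 1 + `|v| + `|w|.
have c0 : 0 < c by rewrite ltr_pwDl // ltr_wpDr.
pose d := r / 2 / c.
have d0 : 0 < d by rewrite !divr_gt0.
have inb s t : 0 <= s <= d -> 0 <= t <= d -> ball x r (x + s *: v + t *: w).
  move=> /andP[s0 sd] /andP[t0 td]; rewrite -ball_normE /=.
  rewrite -addrA opprD addrA subrr sub0r normrN.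
  apply: le_lt_trans (ler_normD _ _) _; rewrite !normrZ !ger0_norm //.
  apply: (@le_lt_trans _ _ (d * c)).
    rewrite /c !mulrDr mulr1 -addrA; apply: ler_wpDl; first exact: ltW.
    by apply: lerD; apply: ler_wpM2r.
  by rewrite /d -mulrA mulVf ?mulr1 ?gt_eqF // gtr_pMr // invf_lt1 // ltr1n.
have [y [/rP[y1 [y2 y3]] yE]] := @second_difference f x v w (ball x r) d (ltW d0)
  inb (fun y yr => df y (rP y yr).2.2) (fun y yr => (Df v).1 y (rP y yr).2.2).
have inb' s t : 0 <= s <= d -> 0 <= t <= d -> ball x r (x + s *: w + t *: v).
  by move=> sd td; rewrite addrAC; exact: inb.
have [z [/rP[z1 [z2 z3]] zE]] := @second_difference f x w v (ball x r) d (ltW d0)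
  inb' (fun y yr => df y (rP y yr).2.2) (fun y yr => (Df w).1 y (rP y yr).2.2).
have {}zE : fvw z = fwv y.
  have dn0 : d != 0 by rewrite gt_eqF.
  apply: (mulIf dn0); apply: (mulIf dn0); rewrite -[LHS]zE -[RHS]yE.
  have diffC (p q p' q' : R) : p - q - (p' - q') = p - p' - (q - q') by ring.
  by rewrite [x + d *: w + _]addrAC; exact: diffC.
move: z1 y2; rewrite -!ball_normE /= zE => z1 y2.
exact: close z1 y2.
Qed.

Lemma derive_sym m (U : set V) (f : V -> 'rV[R]_m) x v w : open U -> U x ->
  Ck 2 U f -> 'D_v (fun y => 'D_w f y) x = 'D_w (fun y => 'D_v f y) x.
Proof.
move=> oU Ux Cf; have [df Df] := Cf.
have dd u u' : derivable (fun y => 'D_u f y) x u'.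
  exact: diff_derivable ((Df u).1 x Ux).
apply/rowP => j; rewrite (derive_mx (dd w v)) (derive_mx (dd v w)).
rewrite [LHS]mxE [RHS]mxE.
have E u u' : 'D_u' (fun y => ('D_u f y) 0 j) x =
    'D_u' (fun y => 'D_u (fun z => f z 0 j : R) y) x.
  apply: (derive_eq_on u' oU _ Ux) => y Uy.
  have dfu : derivable f y u by exact: diff_derivable (df y Uy).
  by rewrite (derive_mx dfu) [LHS]mxE.
rewrite (E w v) (E v w).
have Cfj : Ck 2 U (fun z => f z 0 j : R) by exact: Ck_row_coord.
exact: derive_sym_scalar v w oU Ux Cfj.
Qed.

End second_difference.
End calculus.

(** * Almost complex structures in coordinates *)

Section linear_maps.
Context {R : realType} {V W : lmodType R} (f : V -> W) (lf : linear f).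
Let F : {linear V -> W} := HB.pack f (GRing.isLinear.Build _ _ _ _ _ lf).
(** These rules are for unbundled maps: the operators in charts are linear only at points of an open
    set, so they cannot be bundled as linear maps for all points at once. *)
Lemma linD u v : f (u + v) = f u + f v. Proof. exact: (linearD F). Qed.
Lemma linB u v : f (u - v) = f u - f v. Proof. exact: (linearB F). Qed.
Lemma linN u : f (- u) = - f u. Proof. exact: (linearN F). Qed.
Lemma linZ a u : f (a *: u) = a *: f u. Proof. exact: (linearZ_LR F). Qed.
Lemma lin0 : f 0 = 0. Proof. exact: (linear0 F). Qed.
End linear_maps.

Section algebra.
Context {R : realType} {n : nat}.
Implicit Types (u v w : 'rV[R]_n).

(* In coordinates: [A] is the structure at a point and [D v w] the derivative of
   [A w] in the direction [v]. *)
Definition nij (A : 'rV[R]_n -> 'rV[R]_n) (D : 'rV[R]_n -> 'rV[R]_n -> 'rV[R]_n)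
    v w :=
  D (A v) w - D (A w) v + A (D w v) - A (D v w).

Definition hat_vert (A : 'rV[R]_n -> 'rV[R]_n)
    (D : 'rV[R]_n -> 'rV[R]_n -> 'rV[R]_n) v w u :=
  A u + D v w + 2^-1 *: A (nij A D w v).

Section one_structure.
Variables (A : 'rV[R]_n -> 'rV[R]_n) (D : 'rV[R]_n -> 'rV[R]_n -> 'rV[R]_n).
Hypotheses (lA : linear A) (A2 : forall w, A (A w) = - w).
Hypotheses (lDl : forall w, linear (D ^~ w)) (lDr : forall v, linear (D v)).
Hypothesis DA : forall v w, D v (A w) = - A (D v w).

Let AE := (linD lA, linB lA, linN lA, linZ lA).
Let DlN v w : D (- v) w = - D v w. Proof. exact: (linN (lDl w)). Qed.

Lemma nij_linearl w : linear (nij A D ^~ w).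
Proof.
move=> a u v; rewrite /nij !AE !(linD (lDl _)) !(linD (lDr _)) !(linZ (lDl _)).
by rewrite !(linZ (lDr _)) !AE; apply/rowP => j; rewrite !mxE; ring.
Qed.

Lemma nij_linearr v : linear (nij A D v).
Proof.
move=> a u w; rewrite /nij !AE !(linD (lDl _)) !(linD (lDr _)) !(linZ (lDl _)).
by rewrite !(linZ (lDr _)) !AE; apply/rowP => j; rewrite !mxE; ring.
Qed.

(** The hypothesis [DA] is the derivative of A^2 = -1; it turns the two outer derivatives of [nij]
    into the two inner ones and conversely. *)
Lemma nijA v w : nij A D (A v) w = - A (nij A D v w).
Proof.
rewrite /nij !DA !A2 !DlN !AE !A2.
by apply/rowP => j; rewrite !mxE; ring.
Qed.

Lemma hat_vert_linear v a w u w' u' :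
  hat_vert A D v (a *: w + w') (a *: u + u') =
  a *: hat_vert A D v w u + hat_vert A D v w' u'.
Proof.
rewrite /hat_vert (nij_linearl v) lDr !AE.
by apply/rowP => j; rewrite !mxE; ring.
Qed.

(** Both corrections, [D v w] and half of [A (nij A D w v)], anticommute with [A] as functions of
    [w], so their contributions to the square cancel. *)
Lemma hat_vert_square v w u : hat_vert A D v (A w) (hat_vert A D v w u) = - u.
Proof.
rewrite /hat_vert nijA !AE !A2 DA opprK.
by apply/rowP => j; rewrite !mxE; ring.
Qed.

(** The left side is the bracket expression of the Nijenhuis tensor for fields with values [v] and
    [w]; [p], [q], [r], [s] stand for the derivatives of these fields. That they cancel is the
    tensoriality of the Nijenhuis tensor. *)
Lemma nij_bracket v w p q r s :
  D (A v) w + A p - (D (A w) v + A q) - A (p - (D w v + A s))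
    - A (D v w + A r - q) - (r - s) = nij A D v w.
Proof.
rewrite /nij !(linB lA) !(linD lA) !A2.
by apply/rowP => j; rewrite !mxE; ring.
Qed.

End one_structure.

Section change_of_coordinates.
Variables (A A' T : 'rV[R]_n -> 'rV[R]_n).
Variables (D D' S : 'rV[R]_n -> 'rV[R]_n -> 'rV[R]_n).
Hypotheses (lA' : linear A') (lT : linear T).
Hypothesis (A'2 : forall w, A' (A' w) = - w).
Hypothesis A'T : forall w, A' (T w) = T (A w).
Hypothesis S_sym : forall v w, S v w = S w v.
Hypothesis D'T : forall v w, D' (T v) (T w) = S v (A w) - A' (S v w) + T (D v w).

(** [T] and [S] stand for the first and second derivatives of a transition map, and [D'T] is the
    relation [A'T] differentiated. The terms in [S] cancel in pairs by symmetry. *)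
Lemma nij_change v w : nij A' D' (T v) (T w) = T (nij A D v w).
Proof.
rewrite /nij !A'T !D'T !(linD lA') !(linN lA') !A'T !A'2 !(linD lT) !(linN lT).
rewrite (S_sym (A w) (A v)) (S_sym (A w) v) (S_sym w (A v)) (S_sym w v).
by apply/rowP => j; rewrite !mxE; ring.
Qed.

(** The pair (T w, S v w + T u) is the tangent vector (w, u) at [v] in the new coordinates of the
    bundle. The term [A' (S v w)] that it produces is cancelled by the one in [D'T]. *)
Lemma hat_vert_change v w u :
  hat_vert A' D' (T v) (T w) (S v w + T u) = S v (A w) + T (hat_vert A D v w u).
Proof.
rewrite /hat_vert nij_change D'T !(linD lA') !A'T !(linD lT) (linZ lT).
by apply/rowP => j; rewrite !mxE; ring.
Qed.

End change_of_coordinates.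
End algebra.

Section hat_algebra.
Context {R : realType} {n : nat}.
Variables (A : 'rV[R]_n -> 'rV[R]_n) (D : 'rV[R]_n -> 'rV[R]_n -> 'rV[R]_n).
Variables (E : 'rV[R]_n -> 'rV[R]_n -> 'rV[R]_n -> 'rV[R]_n).
Hypotheses (lA : linear A) (lDl : forall w, linear (D ^~ w)).
Hypothesis E_sym : forall a b w, E a b w = E b a w.
Hypothesis N0 : forall v w, nij A D v w = 0.

(* The vertical part of the Nijenhuis tensor of the complete lift at the vector
   [v] is the derivative of the Nijenhuis tensor along [v]; [E] stands for the
   second derivative of the structure. *)
Lemma complete_lift_nij v w u w' u' :
  E v (A w) w' + D (D v w) w' - (E v (A w') w + D (D v w') w)
    + (D v (D w' w) + A (E v w' w)) - (D v (D w w') + A (E v w w')) = 0 ->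
  D (A w) u' + D (A u + D v w) w' + E (A w) v w'
    - (D (A w') u + D (A u' + D v w') w + E (A w') v w)
    + (A (D w' u + D u' w + E w' v w) + D v (D w' w))
    - (A (D w u' + D u w' + E w v w') + D v (D w w')) = 0.
Proof.
move=> dN0; have := N0 w u'; have := N0 u w'; rewrite /nij => N1 N2.
rewrite !(linD lA) !(linD (lDl _)) (E_sym (A w)) (E_sym (A w')) (E_sym w) (E_sym w').
apply/rowP => j.
move: N1 N2 dN0 => /rowP/(_ j) + /rowP/(_ j) + /rowP/(_ j); rewrite !mxE.
by lra.
Qed.

End hat_algebra.

(** The vector [w] is frozen while the structure is differentiated. Locking keeps the derivative
    from unfolding, so that it acts as the bilinear operation [D] of the algebra above. *)
HB.lock Definition dacs {R : realType} {n : nat}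
    (A : 'rV[R]_n -> 'rV[R]_n -> 'rV[R]_n) (y v w : 'rV[R]_n) : 'rV[R]_n :=
  'D_v (A ^~ w) y.

Lemma dacsE {R : realType} {n : nat} (A : 'rV[R]_n -> 'rV[R]_n -> 'rV[R]_n) y v w :
  dacs A y v w = 'D_v (A ^~ w) y.
Proof. by rewrite dacs.unlock. Qed.

(** * Local almost complex structures and their Nijenhuis tensor *)

Section local_structure.
Context {R : realType}.

Record local_acs {n} (U : set 'rV[R]_n) (A : 'rV[R]_n -> 'rV[R]_n -> 'rV[R]_n) :
  Prop := LocalAcs {
    local_open : open U;
    local_linear : forall y, U y -> linear (A y);
    local_square : forall y w, U y -> A y (A y w) = - w;
    local_smooth : forall w, smooth_on U (A ^~ w) }.

Definition lnij {n} (A : 'rV[R]_n -> 'rV[R]_n -> 'rV[R]_n)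
    (y v w : 'rV[R]_n) : 'rV[R]_n :=
  nij (A y) (dacs A y) v w.

Section fixed.
Context {n : nat} {U : set 'rV[R]_n} {A : 'rV[R]_n -> 'rV[R]_n -> 'rV[R]_n}.
Hypothesis hA : local_acs U A.

Lemma dacs_linearl y w : U y -> linear ((dacs A y) ^~ w).
Proof.
move=> Uy a u v; rewrite !dacsE; apply: derive_dirP.
exact: smooth_differentiable (local_smooth hA w) Uy.
Qed.

Lemma dacs_linearr y v : U y -> linear (dacs A y v).
Proof.
move=> Uy a u w.
have dd w' : derivable (A ^~ w') y v.
  exact: diff_derivable (smooth_differentiable (local_smooth hA w') Uy).
rewrite !dacsE -(deriveZ a (dd u)) -(deriveD (derivableZ (dd u)) (dd w)).
apply: (derive_eq_on v (local_open hA) _ Uy) => z Uz.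
exact: local_linear hA z Uz a u w.
Qed.

Lemma smooth_acs {V : normedModType R} k (P : set V) (f g : V -> 'rV[R]_n) :
  open P -> (forall x, P x -> U (f x)) -> Ck k P f -> Ck k P g ->
  Ck k P (fun x => A (f x) (g x)).
Proof.
move=> oP fU Cf Cg; apply: (Ck_pairing (B := fun x => A (f x))) => //.
  by move=> x /fU; exact: local_linear.
move=> w; apply: (Ck_comp (g := A ^~ w) oP (local_open hA) fU Cf).
exact: local_smooth.
Qed.

Lemma smooth_dacs_cst v w : smooth_on U (fun y => dacs A y v w).
Proof.
under eq_fun do rewrite dacsE; exact: smooth_derive (local_smooth hA w).
Qed.

Lemma smooth_dacs {V : normedModType R} k (P : set V) (f g h : V -> 'rV[R]_n) :
  open P -> (forall x, P x -> U (f x)) -> Ck k P f -> Ck k P g -> Ck k P h ->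
  Ck k P (fun x => dacs A (f x) (g x) (h x)).
Proof.
move=> oP fU Cf Cg Ch; apply: (Ck_pairing (B := fun x => dacs A (f x) (g x))) => //.
  by move=> x /fU Ux; exact: dacs_linearr.
move=> w; apply: (Ck_pairing (B := fun x v => dacs A (f x) v w)) => //.
  by move=> x /fU Ux; exact: dacs_linearl.
move=> v; apply: (Ck_comp (g := fun y => dacs A y v w) oP (local_open hA) fU Cf).
exact: smooth_dacs_cst.
Qed.

Lemma derive_acs f y v : smooth_on U f -> U y ->
  'D_v (fun z => A z (f z)) y = dacs A y v (f y) + A y ('D_v f y).
Proof.
move=> sf Uy; rewrite dacsE.
apply: (derive_pairing v (local_open hA) Uy (local_linear hA)) => //.
by move=> w; exact: local_smooth hA w 1%N.
Qed.

(** The product rule applied to [A z (A z w)], which is constantly [- w] on [U]. *)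
Lemma dacsA y v w : U y -> dacs A y v (A y w) = - A y (dacs A y v w).
Proof.
move=> Uy; have dAw := derive_acs v (local_smooth hA w) Uy.
rewrite -dacsE in dAw.
apply/eqP; rewrite -addr_eq0; apply/eqP; rewrite -[LHS]dAw.
rewrite (derive_eq_on v (local_open hA) (g := fun=> - w) _ Uy) ?derive_cst //.
by move=> z Uz; exact: local_square hA z w Uz.
Qed.

Lemma lnijA y v w : U y -> lnij A y (A y v) w = - A y (lnij A y v w).
Proof.
move=> Uy; apply: nijA => [|w'|w'|v' w']; first exact: local_linear hA _ Uy.
- exact: local_square hA _ _ Uy.
- exact: dacs_linearl.
- exact: dacsA.
Qed.

Lemma lnij_linearl y w : U y -> linear (lnij A y ^~ w).
Proof.
move=> Uy; apply: nij_linearl => [|w'|v']; first exact: local_linear hA _ Uy.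
- exact: dacs_linearl.
- exact: dacs_linearr.
Qed.

Lemma lnij_linearr y v : U y -> linear (lnij A y v).
Proof.
move=> Uy; apply: nij_linearr => [|w'|v']; first exact: local_linear hA _ Uy.
- exact: dacs_linearl.
- exact: dacs_linearr.
Qed.

Lemma smooth_lnij {V : normedModType R} k (P : set V) (f g h : V -> 'rV[R]_n) :
  open P -> (forall x, P x -> U (f x)) -> Ck k P f -> Ck k P g -> Ck k P h ->
  Ck k P (fun x => lnij A (f x) (g x) (h x)).
Proof.
move=> oP fU Cf Cg Ch.
have CA g' : Ck k P g' -> Ck k P (fun x => A (f x) (g' x)) by exact: smooth_acs.
have CD g' h' : Ck k P g' -> Ck k P h' -> Ck k P (fun x => dacs A (f x) (g' x) (h' x)).
  exact: smooth_dacs.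
apply: CkB => //; last by apply: CA; exact: CD.
apply: CkD => //; last by apply: CA; exact: CD.
by apply: CkB => //; apply: CD => //; exact: CA.
Qed.

End fixed.
End local_structure.

Section submatrices.
Context {R : realType}.

Lemma derive_linear_out {V W Z : normedModType R} (L : {linear W -> Z})
    (f : V -> W) x v : continuous L -> differentiable f x ->
  'D_v (fun y => L (f y)) x = L ('D_v f x).
Proof.
move=> cL df; have dL : differentiable L (f x) by exact: linear_differentiable.
by rewrite (derive_chain v df dL) (deriveE _ dL) (diff_lin _ cL).
Qed.

Lemma derive_linear_in {V W Z : normedModType R} (L : {linear V -> W})
    (f : W -> Z) x v : continuous L -> differentiable f (L x) ->
  'D_v (fun y => f (L y)) x = 'D_(L v) f (L x).
Proof.
move=> cL df; have dL : differentiable L x by exact: linear_differentiable.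
by rewrite (derive_chain v dL df) (deriveE _ dL) (diff_lin _ cL).
Qed.

Context {V : normedModType R} {n : nat}.

Lemma Ck_lsubmx k (P : set V) (f : V -> 'rV[R]_(n + n)) : open P ->
  Ck k P f -> Ck k P (fun x => lsubmx (f x)).
Proof.
move=> oP Cf; apply: Ck_row => // j; under eq_fun do rewrite mxE.
exact: Ck_row_coord.
Qed.

Lemma Ck_rsubmx k (P : set V) (f : V -> 'rV[R]_(n + n)) : open P ->
  Ck k P f -> Ck k P (fun x => rsubmx (f x)).
Proof.
move=> oP Cf; apply: Ck_row => // j; under eq_fun do rewrite mxE.
exact: Ck_row_coord.
Qed.

Lemma Ck_row_mx k (P : set V) (f g : V -> 'rV[R]_n) : open P ->
  Ck k P f -> Ck k P g -> Ck k P (fun x => row_mx (f x) (g x)).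
Proof.
move=> oP Cf Cg; apply: Ck_row => // j; case: (split_ordP j) => i ->.
  by under eq_fun do rewrite row_mxEl; exact: Ck_row_coord.
by under eq_fun do rewrite row_mxEr; exact: Ck_row_coord.
Qed.

Lemma Ck_id k m (P : set 'rV[R]_m) : open P -> Ck k P id.
Proof. by move=> oP; apply: Ck_row => // j; exact: Ck_coord. Qed.

Lemma Ck_Zcst k (P : set V) (a : R) (f : V -> 'rV[R]_n) : open P ->
  Ck k P f -> Ck k P (fun x => a *: f x).
Proof. by move=> oP Cf; apply: CkZ => //; exact: Ck_cst. Qed.

Lemma lsubmx_continuous : continuous (lsubmx : 'rV[R]_(n + n) -> 'rV[R]_n).
Proof. exact: continuous_lsubmx. Qed.

Lemma rsubmx_continuous : continuous (rsubmx : 'rV[R]_(n + n) -> 'rV[R]_n).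
Proof. exact: continuous_rsubmx. Qed.

Lemma derive_row_mx (f g : V -> 'rV[R]_n) x v :
  differentiable (fun y => row_mx (f y) (g y)) x ->
  'D_v (fun y => row_mx (f y) (g y)) x = row_mx ('D_v f x) ('D_v g x).
Proof.
move=> dfg; have := derive_linear_out v rsubmx_continuous dfg.
have := derive_linear_out v lsubmx_continuous dfg.
have -> : (fun y => lsubmx (row_mx (f y) (g y))) = f.
  by apply/funext => y; exact: row_mxKl.
have -> : (fun y => rsubmx (row_mx (f y) (g y))) = g.
  by apply/funext => y; exact: row_mxKr.
by move=> -> ->; exact/esym/hsubmxK.
Qed.

End submatrices.

Section submatrix_linearity.
Context {R : realType} {n : nat}.
Implicit Types z : 'rV[R]_(n + n).
Lemma lsubD z1 z2 : lsubmx (z1 + z2) = lsubmx z1 + lsubmx z2.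
Proof. exact: linearD. Qed.
Lemma lsubN z : lsubmx (- z) = - lsubmx z. Proof. exact: linearN. Qed.
Lemma rsubD z1 z2 : rsubmx (z1 + z2) = rsubmx z1 + rsubmx z2.
Proof. exact: linearD. Qed.
Lemma rsubN z : rsubmx (- z) = - rsubmx z. Proof. exact: linearN. Qed.
End submatrix_linearity.

HB.lock Definition ddacs {R : realType} {n : nat}
    (A : 'rV[R]_n -> 'rV[R]_n -> 'rV[R]_n) (y a b w : 'rV[R]_n) : 'rV[R]_n :=
  'D_a (fun x => dacs A x b w) y.

Lemma ddacsE {R : realType} {n : nat} (A : 'rV[R]_n -> 'rV[R]_n -> 'rV[R]_n)
  y a b w : ddacs A y a b w = 'D_a (fun x => dacs A x b w) y.
Proof. by rewrite ddacs.unlock. Qed.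

(** * The lifted structure in coordinates *)

Section complete_lift.
Context {R : realType} {n : nat}.
Variables (U : set 'rV[R]_n) (A : 'rV[R]_n -> 'rV[R]_n -> 'rV[R]_n).
Hypothesis hA : local_acs U A.

(* The structure induced on the tangent bundle, in coordinates: at the vector
   [v] at [y], (w, u) is mapped to (Aw, Au + (D_v A)w + A N(w, v) / 2). *)
Definition hat (z zeta : 'rV[R]_(n + n)) : 'rV[R]_(n + n) :=
  let y := lsubmx z in let w := lsubmx zeta in
  row_mx (A y w) (hat_vert (A y) (dacs A y) (rsubmx z) w (rsubmx zeta)).

Lemma lsub_hat z zeta : lsubmx (hat z zeta) = A (lsubmx z) (lsubmx zeta).
Proof. exact: row_mxKl. Qed.

Definition hat_dom : set 'rV[R]_(n + n) := [set z | U (lsubmx z)].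

Lemma hat_local_acs : local_acs hat_dom hat.
Proof.
have oU := local_open hA.
have oh : open hat_dom by exact: open_lsubmx.
split => // [z /= Uz|z zeta /= Uz|zeta k].
- rewrite /hat_dom /= in Uz *; move=> a z1 z2; rewrite /hat linearP.
  rewrite [X in hat_vert _ _ _ _ X]linearP.
  rewrite (local_linear hA Uz) scale_row_mx add_row_mx; congr row_mx.
  apply: hat_vert_linear => [|w|v]; first exact: local_linear hA _ Uz.
  + exact (dacs_linearl hA w Uz).
  + exact (dacs_linearr hA v Uz).
- rewrite /hat_dom /= in Uz *; rewrite /hat !row_mxKl !row_mxKr.
  rewrite -[in RHS](hsubmxK zeta) opp_row_mx.
  congr row_mx; first exact (local_square hA _ Uz).
  apply: hat_vert_square => [|w|w|v w]; first exact: local_linear hA _ Uz.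
  + exact (local_square hA w Uz).
  + exact (dacs_linearl hA w Uz).
  + exact (dacsA hA v w Uz).
have Cl : Ck k hat_dom (fun z : 'rV[R]_(n + n) => lsubmx z : 'rV[R]_n).
  by apply: Ck_lsubmx => //; exact: Ck_id.
have Cr : Ck k hat_dom (fun z : 'rV[R]_(n + n) => rsubmx z : 'rV[R]_n).
  by apply: Ck_rsubmx => //; exact: Ck_id.
have Cc (c : 'rV[R]_n) : Ck k hat_dom (fun=> c) by exact: Ck_cst.
have CA g : Ck k hat_dom g -> Ck k hat_dom (fun z => A (lsubmx z) (g z)).
  by move=> Cg; apply: (smooth_acs hA (f := lsubmx)).
apply: Ck_row_mx => //; first exact: CA.
apply: CkD => //; first (apply: CkD => //; first exact: CA).
  by apply: (smooth_dacs hA (f := lsubmx)).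
apply: Ck_Zcst => //; apply: CA.
by apply: (smooth_lnij hA (f := lsubmx)).
Qed.

Let hh := hat_local_acs.

(** The first half of [hat] is [A] evaluated on first halves, and taking a half is linear and
    continuous, hence commutes with differentiation. *)
Lemma lsub_dacs_hat z xi zeta : U (lsubmx z) ->
  lsubmx (dacs hat z xi zeta) = dacs A (lsubmx z) (lsubmx xi) (lsubmx zeta).
Proof.
move=> /= Uz; have dh := smooth_differentiable (local_smooth hh zeta) Uz.
rewrite !dacsE -(derive_linear_out xi lsubmx_continuous dh).
have dA := smooth_differentiable (local_smooth hA (lsubmx zeta)) Uz.
rewrite -[RHS](derive_linear_in xi lsubmx_continuous dA).
rewrite (_ : (fun y => lsubmx (hat y zeta)) =
  fun y => A (lsubmx y) (lsubmx zeta)) //.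
by apply/funext => y; exact: row_mxKl.
Qed.

(** Holds without integrability, and so transfers the vanishing of the Nijenhuis tensor from the
    bundle to the base. *)
Lemma lsub_lnij_hat z xi zeta : U (lsubmx z) ->
  lsubmx (lnij hat z xi zeta) = lnij A (lsubmx z) (lsubmx xi) (lsubmx zeta).
Proof.
move=> Uz; rewrite /lnij /nij !lsubD !lsubN.
by rewrite !(lsub_dacs_hat _ _ Uz) !lsub_hat !(lsub_dacs_hat _ _ Uz).
Qed.

Section integrable.
Hypothesis N0 : forall y v w, U y -> lnij A y v w = 0.

Lemma rsub_hat z zeta : U (lsubmx z) -> rsubmx (hat z zeta) =
  A (lsubmx z) (rsubmx zeta) + dacs A (lsubmx z) (rsubmx z) (lsubmx zeta).
Proof.
move=> /= Uz; rewrite row_mxKr /hat_vert -/(lnij A _ _ _) N0 //.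
by rewrite (lin0 (local_linear hA Uz)) scaler0 addr0.
Qed.

(** In A(y) u + (D_v A) w the first summand depends on the point (y, v) through y alone, the second
    through y and, linearly, through v: one term comes from the first and two from the second. *)
Lemma rsub_dacs_hat z xi zeta : U (lsubmx z) ->
  rsubmx (dacs hat z xi zeta) =
    dacs A (lsubmx z) (lsubmx xi) (rsubmx zeta)
    + dacs A (lsubmx z) (rsubmx xi) (lsubmx zeta)
    + ddacs A (lsubmx z) (lsubmx xi) (rsubmx z) (lsubmx zeta).
Proof.
move=> /= Uz; have oh := local_open hh.
have dh := smooth_differentiable (local_smooth hh zeta) Uz.
rewrite dacsE -(derive_linear_out xi rsubmx_continuous dh).
pose w := lsubmx zeta; pose u := rsubmx zeta.
have Cl k : Ck k hat_dom (fun z : 'rV[R]_(n + n) => lsubmx z : 'rV[R]_n).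
  by apply: Ck_lsubmx => //; exact: Ck_id.
have Cr k : Ck k hat_dom (fun z : 'rV[R]_(n + n) => rsubmx z : 'rV[R]_n).
  by apply: Ck_rsubmx => //; exact: Ck_id.
pose f1 (z : 'rV[R]_(n + n)) := A (lsubmx z) u.
pose f2 (z : 'rV[R]_(n + n)) := dacs A (lsubmx z) (rsubmx z) w.
have C1 : Ck 1 hat_dom f1.
  by apply: (smooth_acs hA (f := lsubmx)) => //; exact: Ck_cst.
have hU (x : 'rV[R]_(n + n)) : hat_dom x -> U (lsubmx x) by [].
have C2 : Ck 1 hat_dom f2.
  exact (smooth_dacs hA oh hU (Cl 1%N) (Cr 1%N) (Ck_cst 1 hat_dom w)).
have d1 : derivable f1 z xi by exact: diff_derivable (C1.1 z Uz).
have d2 : derivable f2 z xi by exact: diff_derivable (C2.1 z Uz).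
have lB (x : 'rV[R]_(n + n)) : hat_dom x -> linear (fun v => dacs A (lsubmx x) v w).
  by move=> Ux; exact (dacs_linearl hA w Ux).
have CB v : Ck 1 hat_dom (fun x => dacs A (lsubmx x) v w).
  exact (smooth_dacs hA oh hU (Cl 1%N) (Ck_cst 1 hat_dom v) (Ck_cst 1 hat_dom w)).
have E1 : 'D_xi f1 z = dacs A (lsubmx z) (lsubmx xi) u.
  have dA := smooth_differentiable (local_smooth hA u) Uz.
  by rewrite dacsE; exact (derive_linear_in xi lsubmx_continuous dA).
have Ed : 'D_xi (fun x => dacs A (lsubmx x) (rsubmx z) w) z =
    ddacs A (lsubmx z) (lsubmx xi) (rsubmx z) w.
  have dD := smooth_differentiable (smooth_dacs_cst hA (rsubmx z) w) Uz.
  by rewrite ddacsE; exact (derive_linear_in xi lsubmx_continuous dD).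
have Er : 'D_xi (rsubmx : 'rV[R]_(n + n) -> 'rV[R]_n) z = rsubmx xi.
  have drs : differentiable (id : 'rV[R]_(n + n) -> _) z by [].
  by have := derive_linear_out xi rsubmx_continuous drs; rewrite derive_id.
have E2 : 'D_xi f2 z = ddacs A (lsubmx z) (lsubmx xi) (rsubmx z) w +
    dacs A (lsubmx z) (rsubmx xi) w.
  by rewrite -Ed -Er; exact (derive_pairing xi oh Uz lB CB (Cr 1%N)).
rewrite (derive_eq_on xi oh (g := f1 + f2) _ Uz) => [|y Uy]; last exact: rsub_hat.
by rewrite (deriveD d1 d2) E1 E2 -addrA [X in _ + X]addrC.
Qed.

Lemma ddacs_sym y a b w : U y -> ddacs A y a b w = ddacs A y b a w.
Proof.
move=> Uy; have E c : (fun x => dacs A x c w) = (fun x => 'D_c (A ^~ w) x).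
  by apply/funext => x; rewrite dacsE.
rewrite !ddacsE !E.
exact (derive_sym a b (local_open hA) Uy (local_smooth hA w 2)).
Qed.

(** The product rule applied to the function [lnij A x w w'] of [x], which vanishes on [U]. This is
    the premise of [complete_lift_nij]. *)
Lemma derive_lnij y v w w' : U y ->
  ddacs A y v (A y w) w' + dacs A y (dacs A y v w) w'
    - (ddacs A y v (A y w') w + dacs A y (dacs A y v w') w)
    + (dacs A y v (dacs A y w' w) + A y (ddacs A y v w' w))
    - (dacs A y v (dacs A y w w') + A y (ddacs A y v w w')) = 0.
Proof.
move=> Uy; have oU := local_open hA.
have N0' : 'D_v (fun x => lnij A x w w') y = 0.
  by rewrite (derive_eq_on v oU (g := fun=> 0) _ Uy) ?derive_cst // => x Ux; exact: N0.
have D1 a b : 'D_v (fun x => dacs A x (A x a) b) y =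
    ddacs A y v (A y a) b + dacs A y (dacs A y v a) b.
  rewrite ddacsE (dacsE A y v a).
  have lB x : U x -> linear (fun u => dacs A x u b).
    by move=> Ux; exact (dacs_linearl hA b Ux).
  have CB u : Ck 1 U (fun x => dacs A x u b) by exact: smooth_dacs_cst.
  exact (derive_pairing v oU Uy lB CB (local_smooth hA a 1)).
have D2 a b : 'D_v (fun x => A x (dacs A x a b)) y =
    dacs A y v (dacs A y a b) + A y (ddacs A y v a b).
  by rewrite ddacsE; exact (derive_acs hA v (smooth_dacs_cst hA a b) Uy).
have C1 a b : derivable (fun x => dacs A x (A x a) b) y v.
  apply: diff_derivable.
  have C : Ck 1 U (fun x => dacs A x (A x a) b).
    apply: (smooth_dacs hA oU _ (Ck_id 1 oU) _ (Ck_cst _ _ b)) => //.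
    exact: local_smooth hA a 1%N.
  exact: C.1.
have C2 a b : derivable (fun x => A x (dacs A x a b)) y v.
  apply: diff_derivable.
  have C : Ck 1 U (fun x => A x (dacs A x a b)).
    apply: (smooth_acs hA oU _ (Ck_id 1 oU)) => //.
    exact: smooth_dacs_cst hA a b 1%N.
  exact: C.1.
rewrite -!D1 -!D2 -N0'.
rewrite -(deriveB (C1 w w') (C1 w' w)).
rewrite -(deriveD (derivableB (C1 w w') (C1 w' w)) (C2 w' w)).
by rewrite -(deriveB (derivableD (derivableB (C1 w w') (C1 w' w)) (C2 w' w)) (C2 w w')).
Qed.

Lemma lnij_hat z xi zeta : U (lsubmx z) -> lnij hat z xi zeta = 0.
Proof.
move=> /= Uz; rewrite -[LHS]hsubmxK lsub_lnij_hat // N0 //.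
suff -> : rsubmx (lnij hat z xi zeta) = 0 by rewrite row_mx0.
rewrite /lnij /nij !rsubD !rsubN !(rsub_hat _ Uz) !(rsub_dacs_hat _ _ Uz).
rewrite !lsub_hat !(lsub_dacs_hat _ _ Uz) !(rsub_hat _ Uz).
apply: (complete_lift_nij (E := ddacs A (lsubmx z))); last exact: derive_lnij.
- exact (local_linear hA Uz).
- by move=> w; exact (dacs_linearl hA w Uz).
- by move=> a b w; exact: ddacs_sym.
- by move=> v w; exact: N0.
Qed.

End integrable.
End complete_lift.

Lemma derive_dir_linear {R : realType} {V W : normedModType R} (U : set V)
    (tau : V -> W) y : smooth_on U tau -> U y -> linear (fun v : V => 'D_v tau y).
Proof.
by move=> st Uy a u v; apply: derive_dirP; exact: smooth_differentiable st Uy.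
Qed.

(** * Independence of the coordinates *)

Section coordinate_change.
Context {R : realType} {n : nat}.
Variables (U U' : set 'rV[R]_n).
Variables (A A' : 'rV[R]_n -> 'rV[R]_n -> 'rV[R]_n).
Variable (tau : 'rV[R]_n -> 'rV[R]_n).
Hypotheses (hA : local_acs U A) (hA' : local_acs U' A').
Hypotheses (tauU : forall y, U y -> U' (tau y)) (stau : smooth_on U tau).
Hypothesis A'tau : forall y w, U y -> A' (tau y) ('D_w tau y) = 'D_(A y w) tau y.

Let S y v w : 'rV[R]_n := 'D_v (fun x => 'D_w tau x) y.

Let oU := local_open hA.

(** Obtained by differentiating [A'tau] along [v], with the product rule on each side. *)
Lemma dacs_change y v w : U y ->
  dacs A' (tau y) ('D_v tau y) ('D_w tau y) =
  S y v (A y w) - A' (tau y) (S y v w) + 'D_(dacs A y v w) tau y.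
Proof.
move=> Uy.
have lB x : U x -> linear (A' (tau x)) by move=> /tauU; exact: local_linear.
have CB u : Ck 1 U (fun x => A' (tau x) u).
  exact (Ck_comp oU (local_open hA') tauU (stau 1%N) (local_smooth hA' u 1)).
have Ct : Ck 1 U (fun x => 'D_w tau x) by exact: smooth_derive stau 1%N.
have E1 : 'D_v (fun x => A' (tau x) ('D_w tau x)) y =
    dacs A' (tau y) ('D_v tau y) ('D_w tau y) + A' (tau y) (S y v w).
  rewrite dacsE -(derive_chain v (smooth_differentiable stau Uy)
    (smooth_differentiable (local_smooth hA' ('D_w tau y)) (tauU Uy))).
  exact (derive_pairing v oU Uy lB CB Ct).
have E2 : 'D_v (fun x => 'D_(A x w) tau x) y =
    S y v (A y w) + 'D_(dacs A y v w) tau y.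
  have CD u : Ck 1 U (fun x => 'D_u tau x) by exact: smooth_derive stau 1%N.
  rewrite dacsE.
  exact (derive_pairing v oU Uy (fun x => derive_dir_linear stau) CD
    (local_smooth hA w 1)).
have E3 := derive_eq_on v oU (fun x Ux => A'tau w Ux) Uy.
by rewrite E1 E2 in E3; rewrite addrAC -E3 addrK.
Qed.

Lemma S_sym y v w : U y -> S y v w = S y w v.
Proof. move=> Uy; exact (derive_sym v w oU Uy (stau 2)). Qed.

(** The tangent map of [tau]: a transition map of TM when [tau] is one of M. *)
Definition tau_hat (z : 'rV[R]_(n + n)) : 'rV[R]_(n + n) :=
  row_mx (tau (lsubmx z)) ('D_(rsubmx z) tau (lsubmx z)).

Lemma smooth_tau_hat : smooth_on (hat_dom U) tau_hat.
Proof.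
move=> k; have oh : open (hat_dom U) by exact: open_lsubmx.
have Cl : Ck k (hat_dom U) (fun z : 'rV[R]_(n + n) => lsubmx z : 'rV[R]_n).
  by apply: Ck_lsubmx => //; exact: Ck_id.
have Cr : Ck k (hat_dom U) (fun z : 'rV[R]_(n + n) => rsubmx z : 'rV[R]_n).
  by apply: Ck_rsubmx => //; exact: Ck_id.
have hU (x : 'rV[R]_(n + n)) : hat_dom U x -> U (lsubmx x) by [].
apply: Ck_row_mx => //; first exact (Ck_comp oh oU hU Cl (stau k)).
apply: (Ck_pairing (B := fun z u => 'D_u tau (lsubmx z)) oh _ _ Cr).
  by move=> x Ux; exact (derive_dir_linear stau (hU x Ux)).
move=> u.
exact (Ck_comp (g := fun x => 'D_u tau x) oh oU hU Cl (smooth_derive u stau k)).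
Qed.

Lemma derive_tau_hat z zeta : U (lsubmx z) ->
  'D_zeta tau_hat z = row_mx ('D_(lsubmx zeta) tau (lsubmx z))
    (S (lsubmx z) (rsubmx z) (lsubmx zeta) + 'D_(rsubmx zeta) tau (lsubmx z)).
Proof.
move=> Uz; have oh : open (hat_dom U) by exact: open_lsubmx.
have hU (x : 'rV[R]_(n + n)) : hat_dom U x -> U (lsubmx x) by [].
have Cl k : Ck k (hat_dom U) (fun z : 'rV[R]_(n + n) => lsubmx z : 'rV[R]_n).
  by apply: Ck_lsubmx => //; exact: Ck_id.
have Cr k : Ck k (hat_dom U) (fun z : 'rV[R]_(n + n) => rsubmx z : 'rV[R]_n).
  by apply: Ck_rsubmx => //; exact: Ck_id.
have dt := smooth_differentiable smooth_tau_hat Uz.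
rewrite /tau_hat (derive_row_mx zeta dt); congr row_mx.
  exact (derive_linear_in zeta lsubmx_continuous (smooth_differentiable stau Uz)).
(* The product rule yields the second derivative with its arguments in the opposite order to that
   used by [hat_vert_change]. *)
rewrite (S_sym _ _ Uz).
have Er : 'D_zeta (rsubmx : 'rV[R]_(n + n) -> 'rV[R]_n) z = rsubmx zeta.
  have drs : differentiable (id : 'rV[R]_(n + n) -> _) z by [].
  by have := derive_linear_out zeta rsubmx_continuous drs; rewrite derive_id.
have Ed : 'D_zeta (fun x : 'rV[R]_(n + n) => 'D_(rsubmx z) tau (lsubmx x)) z =
    S (lsubmx z) (lsubmx zeta) (rsubmx z).
  exact (derive_linear_in zeta lsubmx_continuous
    (smooth_differentiable (smooth_derive (rsubmx z) stau) Uz)).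
rewrite -Er -Ed.
apply (derive_pairing (B := fun (x : 'rV[R]_(n + n)) u => 'D_u tau (lsubmx x))
  zeta oh Uz); last exact (Cr 1%N).
  by move=> x Ux; exact (derive_dir_linear stau (hU x Ux)).
move=> u; exact (Ck_comp (g := fun x => 'D_u tau x) oh oU hU (Cl 1%N)
  (smooth_derive u stau 1)).
Qed.

Lemma hat_change z zeta : U (lsubmx z) ->
  hat A' (tau_hat z) ('D_zeta tau_hat z) = 'D_(hat A z zeta) tau_hat z.
Proof.
move=> Uz; rewrite !(derive_tau_hat _ Uz) /hat !row_mxKl !row_mxKr.
rewrite (A'tau _ Uz); congr row_mx.
apply: (hat_vert_change (T := fun v => 'D_v tau (lsubmx z)) (S := S (lsubmx z))).
- exact (local_linear hA' (tauU Uz)).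
- exact (derive_dir_linear stau Uz).
- by move=> u; exact (local_square hA' u (tauU Uz)).
- by move=> u; exact (A'tau u Uz).
- by move=> u u'; exact (S_sym u u' Uz).
- by move=> u u'; exact (dacs_change u u' Uz).
Qed.

End coordinate_change.

(** * Charts *)

Section open_preimages.
Context {R : realType}.

Lemma open_preimage_on {V W : topologicalType} (P : set V) (f : V -> W) (Q : set W) :
  open P -> (forall x, P x -> {for x, continuous f}) -> open Q ->
  open (P `&` f @^-1` Q).
Proof.
move=> oP cf oQ; rewrite openE => x [Px Qfx]; apply: filterI.
  exact: open_nbhs_nbhs.
exact: (cf x Px _ (open_nbhs_nbhs (conj oQ Qfx))).
Qed.

End open_preimages.

HB.lock Definition chart_bracket {R : realType} {n : nat}
    (X Y : 'rV[R]_n -> 'rV[R]_n) (y : 'rV[R]_n) : 'rV[R]_n :=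
  'D_(X y) Y y - 'D_(Y y) X y.

Lemma chart_bracketE {R : realType} {n : nat} (X Y : 'rV[R]_n -> 'rV[R]_n) y :
  chart_bracket X Y y = 'D_(X y) Y y - 'D_(Y y) X y.
Proof. by rewrite chart_bracket.unlock. Qed.

Section manifold_charts.
Context {R : realType} {n : nat} {M : manifold R n}.
Implicit Types (X Y : M -> 'rV[R]_n) (i j : chart_index M) (x : M).

Definition trans i j (y : 'rV[R]_n) : 'rV[R]_n := chart j (param i y).

Lemma trans_smooth i j : smooth_on (overlap i j) (trans i j).
Proof. exact: transition_smooth. Qed.

Lemma overlap_cod i j y : overlap i j y -> cod i y.
Proof. by rewrite overlapE => -[]. Qed.

Lemma overlap_dom i j y : overlap i j y -> dom i (param i y) /\ dom j (param i y).
Proof. by rewrite overlapE => -[/cod_dom]. Qed.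

Lemma trans_overlap i j y : overlap i j y -> overlap j i (trans i j y).
Proof. by move=> /overlap_dom[di dj]; exact: overlap_chart. Qed.

Lemma transK i j y : overlap i j y -> trans j i (trans i j y) = y.
Proof.
move=> o; have [di dj] := overlap_dom o.
by rewrite /trans chartK // paramK //; exact: overlap_cod o.
Qed.

Lemma param_trans i j y : overlap i j y -> param j (trans i j y) = param i y.
Proof. by move=> /overlap_dom[di dj]; exact: chartK. Qed.

Lemma dchart_linear i x : linear (dchart i x).
Proof. by move=> a u v; rewrite /dchart linearP. Qed.

Lemma dparam_linear i x : linear (dparam i x).
Proof. by move=> a u v; rewrite /dparam linearP. Qed.

Lemma derive_trans i j y v : overlap i j y ->
  'D_v (trans i j) y = dchart j (param i y) (dparam i (param i y) v).
Proof.
move=> o; have [di dj] := overlap_dom o.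
rewrite dchart_dparam // paramK ?deriveE //; last exact: overlap_cod o.
exact: transition_differentiable.
Qed.

Lemma dchart_trans i j x v : dom i x -> dom j x ->
  dchart j x v = 'D_(dchart i x v) (trans i j) (chart i x).
Proof.
move=> di dj; rewrite derive_trans; last exact: overlap_chart.
by rewrite chartK // dchartK.
Qed.

Lemma dchart_at x v : dchart (chart_at x) x v = v.
Proof. exact/diff_transition_id/dom_cod/chart_atP. Qed.

Lemma local_field_at X x : local_field (chart_at x) X (chart (chart_at x) x) = X x.
Proof. by rewrite /local_field chartK ?dchart_at //; exact: chart_atP. Qed.

Lemma local_field_dom i X x : dom i x ->
  local_field i X (chart i x) = dchart i x (X x).
Proof. by move=> di; rewrite /local_field chartK. Qed.

Lemma local_field_trans i j X y : overlap i j y ->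
  local_field j X (trans i j y) = 'D_(local_field i X y) (trans i j) y.
Proof.
move=> o; have [di dj] := overlap_dom o.
by rewrite /local_field derive_trans // param_trans // dchartK.
Qed.

Lemma open_trans_preimage i j (Q : set 'rV[R]_n) : open Q ->
  open (overlap i j `&` trans i j @^-1` Q).
Proof.
apply: open_preimage_on; first exact: overlap_open.
move=> y oy; apply: differentiable_continuous.
exact: smooth_differentiable (trans_smooth i j) oy.
Qed.

(** In any other chart the field is the given representation, carried over by the transition map and
    its derivative, both smooth; so one chart near each point decides. *)
Lemma smooth_field_local X :
  (forall x, exists i (V : set 'rV[R]_n), [/\ dom i x, open V, V (chart i x) &
    smooth_on V (local_field i X)]) -> smooth_field X.
Proof.
move=> locX j k; apply: Ck_local => y cy.
have [i [V [di oV Vy sX]]] := locX (param j y).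
have oji : overlap j i y by rewrite overlapE.
have oij := trans_overlap oji.
pose W := overlap j i `&` trans j i @^-1` V.
have oW : open W by exact: open_trans_preimage.
exists W; split => //.
have CT : Ck k W (trans j i).
  have WO : W `<=` overlap j i by move=> z [].
  exact (Ck_subset WO (trans_smooth j i k)).
have WV z : W z -> V (trans j i z) by case.
have Wo z : W z -> overlap i j (trans j i z) by case=> /trans_overlap.
apply: (Ck_eq oW (f := fun z =>
    'D_(local_field i X (trans j i z)) (trans i j) (trans j i z))).
  by move=> z Wz; rewrite -local_field_trans ?transK //; [exact: Wz.1|exact: Wo].
have CX : Ck k W (fun z => local_field i X (trans j i z)).
  exact: (Ck_comp (g := local_field i X) oW oV WV CT (sX k)).
apply: (Ck_pairing (B := fun z u => 'D_u (trans i j) (trans j i z)) oW _ _ CX).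
  by move=> z Wz; exact (derive_dir_linear (trans_smooth i j) (Wo z Wz)).
move=> u; apply: (Ck_comp (g := fun z => 'D_u (trans i j) z) oW _ Wo CT).
  exact: overlap_open.
exact: smooth_derive (trans_smooth i j) k.
Qed.

Lemma smooth_field_diff X i y : smooth_field X -> cod i y ->
  differentiable (local_field i X) y.
Proof. by move=> sX; exact: smooth_differentiable (sX i). Qed.

Lemma derive_local_field_trans i j X Y y : smooth_field X -> smooth_field Y ->
  overlap i j y ->
  'D_(local_field j X (trans i j y)) (local_field j Y) (trans i j y) =
  'D_(local_field i X y) (fun z => 'D_(local_field i Y y) (trans i j) z) y
    + 'D_('D_(local_field i X y) (local_field i Y) y) (trans i j) y.
Proof.
move=> sX sY o; have oO := @overlap_open _ _ M i j.
rewrite local_field_trans //.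
have dt := smooth_differentiable (trans_smooth i j) o.
have dY := smooth_field_diff sY (overlap_cod (trans_overlap o)).
rewrite -(derive_chain _ dt dY).
rewrite (derive_eq_on _ oO (fun z oz => local_field_trans Y oz) o).
have sYi : smooth_on (overlap i j) (local_field i Y).
  have oc : overlap i j `<=` cod i by move=> z; exact: overlap_cod.
  by move=> k; exact (Ck_subset oc (sY i k)).
have lB z : overlap i j z -> linear (fun u : 'rV[R]_n => 'D_u (trans i j) z).
  by move=> oz; exact (derive_dir_linear (trans_smooth i j) oz).
exact (derive_pairing (local_field i X y) oO o lB
  (fun u => smooth_derive u (trans_smooth i j) 1) (sYi 1)).
Qed.

(** Each half of the bracket acquires a second derivative of the transition map; by symmetry these
    two terms are equal and cancel. *)
Lemma chart_bracket_trans i j X Y y : smooth_field X -> smooth_field Y ->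
  overlap i j y ->
  chart_bracket (local_field j X) (local_field j Y) (trans i j y) =
  'D_(chart_bracket (local_field i X) (local_field i Y) y) (trans i j) y.
Proof.
move=> sX sY o; rewrite !chart_bracketE (derive_local_field_trans sX sY o).
rewrite (derive_local_field_trans sY sX o).
have lt := derive_dir_linear (trans_smooth i j) o.
have oO := @overlap_open _ _ M i j.
rewrite (linB lt) (derive_sym (local_field i X y) (local_field i Y y) oO o
  (trans_smooth i j 2)).
by rewrite opprD addrACA subrr add0r.
Qed.

Lemma lie_bracket_at X Y x : lie_bracket X Y x =
  chart_bracket (local_field (chart_at x) X) (local_field (chart_at x) Y)
    (chart (chart_at x) x).
Proof. by rewrite chart_bracketE !local_field_at. Qed.

(** Frees the bracket from the preferred chart in which it is defined. *)
Lemma lie_bracket_chart i X Y x : smooth_field X -> smooth_field Y -> dom i x ->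
  dchart i x (lie_bracket X Y x) =
  chart_bracket (local_field i X) (local_field i Y) (chart i x).
Proof.
move=> sX sY di; have dc := chart_atP x; have o := overlap_chart dc di.
rewrite lie_bracket_at (dchart_trans _ dc di) dchart_at.
by rewrite -(chart_bracket_trans sX sY o) /trans (chartK dc).
Qed.

Lemma smooth_function_diff (f : M -> R) i y : smooth_function f -> cod i y ->
  differentiable (fun z => f (param i z)) y.
Proof. by move=> sf; exact: smooth_differentiable (sf i). Qed.

Lemma field_derive_chart i X (f : M -> R) x : smooth_function f -> dom i x ->
  field_derive X f x =
  'D_(local_field i X (chart i x)) (fun z => f (param i z)) (chart i x).
Proof.
move=> sf di; have dc := chart_atP x; have o := overlap_chart dc di.
have -> : chart i x = trans (chart_at x) i (chart (chart_at x) x).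
  by rewrite /trans chartK.
rewrite local_field_trans // local_field_at.
rewrite -(derive_chain _ (smooth_differentiable (trans_smooth _ _) o)
  (smooth_function_diff sf (overlap_cod (trans_overlap o)))).
apply: (derive_eq_on _ (@overlap_open _ _ M (chart_at x) i) _ o) => z oz.
by rewrite /= param_trans.
Qed.

End manifold_charts.

(** * The Nijenhuis tensor in an arbitrary chart *)

Section nijenhuis_in_charts.
Context {R : realType} {n : nat} {M : manifold R n}.
Variable J : almost_complex_structure M.
Implicit Types (X Y : M -> 'rV[R]_n) (i j : chart_index M) (x : M).

Definition local_J i (y w : 'rV[R]_n) : 'rV[R]_n :=
  dchart i (param i y) (J (param i y) (dparam i (param i y) w)).

Lemma local_J_acs i : local_acs (cod i) (local_J i).
Proof.
split => [|y cy|y w cy|w]; first exact: chart_open.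
- move=> a u v; rewrite /local_J.
  by rewrite (dparam_linear i _ a u v) linearP (dchart_linear i _ a).
- by rewrite /local_J dchartK ?acs_square ?(linN (dchart_linear i _)) ?dparamK //;
    exact: cod_dom.
- exact: acs_smooth.
Qed.

Lemma local_J_dom i x v : dom i x ->
  dchart i x (J x v) = local_J i (chart i x) (dchart i x v).
Proof. by move=> di; rewrite /local_J chartK // dchartK. Qed.

Lemma local_J_trans i j y w : overlap i j y ->
  local_J j (trans i j y) ('D_w (trans i j) y) = 'D_(local_J i y w) (trans i j) y.
Proof.
move=> o; have [di dj] := overlap_dom o.
by rewrite !derive_trans // /local_J param_trans // !dchartK.
Qed.

Lemma local_acs_field i X y : cod i y ->
  local_field i (acs_field J X) y = local_J i y (local_field i X y).
Proof.
move=> cy; rewrite /local_J /local_field /acs_field dchartK //.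
exact: cod_dom.
Qed.

Lemma smooth_acs_field X : smooth_field X -> smooth_field (acs_field J X).
Proof.
move=> sX i k; have hJ := local_J_acs i; have oc := local_open hJ.
apply: (Ck_eq oc (f := fun y => local_J i y (local_field i X y))).
  by move=> y cy; rewrite local_acs_field.
exact (smooth_acs hJ oc (fun y cy => cy) (Ck_id k oc) (sX i k)).
Qed.

Lemma derive_acs_field i X y v : smooth_field X -> cod i y ->
  'D_v (local_field i (acs_field J X)) y =
  dacs (local_J i) y v (local_field i X y)
    + local_J i y ('D_v (local_field i X) y).
Proof.
move=> sX cy; have hJ := local_J_acs i.
rewrite (derive_eq_on v (local_open hJ) (@local_acs_field i X) cy).
exact (derive_acs hJ v (sX i) cy).
Qed.

(** Each of the four brackets is computed in the chart [i], and [nij_bracket] removes the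
    derivatives of the fields; only their values at [x] remain. *)
Lemma nijenhuis_chart i X Y x : smooth_field X -> smooth_field Y -> dom i x ->
  dchart i x (nijenhuis J X Y x) =
  lnij (local_J i) (chart i x) (local_field i X (chart i x))
    (local_field i Y (chart i x)).
Proof.
move=> sX sY di; have lc := dchart_linear i x; have cy := dom_cod di.
have sJX := smooth_acs_field sX; have sJY := smooth_acs_field sY.
have split4 a b c d a' b' c' d' : dchart i x a = a' -> dchart i x b = b' ->
    dchart i x c = c' -> dchart i x d = d' ->
    dchart i x (a - J x b - J x c - d) =
    a' - local_J i (chart i x) b' - local_J i (chart i x) c' - d'.
  by move=> <- <- <- <-; rewrite !(linB lc) !(local_J_dom _ di).
apply: etrans (split4 _ _ _ _ _ _ _ _
  (lie_bracket_chart sJX sJY di) (lie_bracket_chart sJX sY di)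
  (lie_bracket_chart sX sJY di) (lie_bracket_chart sX sY di)) _.
have EX := local_acs_field X cy; have EY := local_acs_field Y cy.
have dJX v := derive_acs_field v sX cy; have dJY v := derive_acs_field v sY cy.
rewrite !chart_bracketE EX EY !dJX !dJY.
have hJ := local_J_acs i.
exact (nij_bracket (dacs (local_J i) (chart i x)) (local_linear hJ cy)
  (fun w => local_square hJ w cy) _ _ _ _ _ _).
Qed.

End nijenhuis_in_charts.

(** * Cutoff functions *)

Section flat_function.
Context {R : realType}.

(** The derivative of x^(-m) exp(-1/x) is a combination of the functions with exponents m + 1 and m
    + 2. Carrying the whole family therefore reduces smoothness to an induction. *)
Definition flat (m : nat) (x : R) : R :=
  if 0 < x then x^-1 ^+ m * expR (- x^-1) else 0.

Lemma flat_ge0 m x : 0 <= flat m x.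
Proof.
rewrite /flat; case: ifPn => // x0.
by rewrite mulr_ge0 ?expR_ge0 // exprn_ge0 // invr_ge0 ltW.
Qed.

Lemma flat_gt0 m x : 0 < x -> 0 < flat m x.
Proof. by move=> x0; rewrite /flat x0 mulr_gt0 ?expR_gt0 // exprn_gt0 // invr_gt0. Qed.

Lemma flat_le0 m x : x <= 0 -> flat m x = 0.
Proof. by move=> x0; rewrite /flat ltNge x0. Qed.

(** For t = 1/x > 0 the exponential series gives exp(t) >= t^(m+1) / (m+1)!. The bound serves for
    continuity at 0. *)
Lemma flat_bound m x : flat m x <= m.+1`!%:R * `|x|.
Proof.
have [x0|x0] := leP x 0; first by rewrite flat_le0 // mulr_ge0.
rewrite /flat x0 (gtr0_norm x0); set t := x^-1.
have t0 : 0 < t by rewrite invr_gt0.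
have f0 : 0 < (m.+1`!%:R : R) by rewrite ltr0n fact_gt0.
have : t ^+ m.+1 / m.+1`!%:R <= expR t.
  by apply: le_trans (expR_ge1Dxn m (ltW t0)); rewrite lerDr.
rewrite ler_pdivrMr // => te; rewrite expRN -ler_pdivlMr; last first.
  by rewrite invr_gt0 expR_gt0.
rewrite invrK -[x]invrK -/t mulrAC ler_pdivlMr // -exprSr mulrC.
exact: te.
Qed.

Lemma flat_continuous0 m : flat m h @[h --> 0] --> (0 : R).
Proof.
have f0 : 0 < (m.+1`!%:R : R) by rewrite ltr0n fact_gt0.
apply/cvgr0Pnorm_lt => e e0; near=> h.
rewrite ger0_norm ?flat_ge0 //; apply: le_lt_trans (flat_bound m h) _.
rewrite mulrC -ltr_pdivlMr //.
near: h; exists (e / m.+1`!%:R); first by rewrite /= divr_gt0.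
by move=> y /=; rewrite sub0r normrN.
Unshelve. all: by end_near. Qed.


Let power_exp m (t : R) := t ^+ m * expR (- t).

Lemma is_derive_power_exp (m : nat) (t : R) :
  is_derive t 1 (power_exp m) ((m%:R * t ^+ m.-1 - t ^+ m) * expR (- t)).
Proof.
have de : is_derive t 1 (fun t => expR (- t)) (- expR (- t)).
  by apply: is_derive_eq; rewrite mulrN1.
have dX : is_derive t 1 (fun t => t ^+ m) (m%:R * t ^+ m.-1).
  have -> : (fun t : R => t ^+ m) = (@id R) ^+ m.
    by apply/funext => y; rewrite exprfctE.
  by apply: is_derive_eq; rewrite /= scaler1 mulr_natl.
apply: (is_derive_eq (is_deriveM dX de)).
by rewrite /GRing.scale /=; ring.
Qed.

Lemma is_derive_flat (m : nat) (x : R) :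
  is_derive x 1 (flat m) (flat m.+2 x - m%:R * flat m.+1 x).
Proof.
have [x0|x0|->] := ltgtP x 0.
- rewrite !flat_le0 ?ltW // mulr0 subr0.
  apply: (near_eq_is_derive (f := cst 0)) => //.
  near=> y; rewrite flat_le0 //; apply: ltW.
  by near: y; exact: lt_nbhsl.
- have xn0 : x != 0 by rewrite gt_eqF.
  have N : \near x, power_exp m x^-1 = flat m x.
    by near=> y; rewrite /flat ifT //; near: y; exact: lt_nbhsr.
  apply: near_eq_is_derive N _.
  have dp t : differentiable (power_exp m) t.
    by apply/derivable1_diffP; have [] := is_derive_power_exp m t.
  have dV : differentiable (fun y : R => y^-1) x.
    by apply: (@differentiableV _ _ id).
  have dpV : differentiable (fun y : R => power_exp m y^-1) x.
    exact: (@differentiable_comp _ _ _ _ (fun y : R => y^-1) (power_exp m)).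
  apply: DeriveDef; first exact: diff_derivable.
  rewrite (derive_chain (1 : R) dV (dp _)).
  have -> : 'D_1 (fun y : R => y^-1) x = - x ^- 2.
    by rewrite (@deriveV _ _ id) // derive_id scaler1.
  rewrite deriveE //.
  have -> : - x ^- 2 = - x ^- 2 *: (1 : R) by rewrite /GRing.scale /= mulr1.
  rewrite linearZ /= -deriveE //; have [_ ->] := is_derive_power_exp m x^-1.
  rewrite /flat x0.
  rewrite /GRing.scale /=; case: (m) => [|m'] /=; first by field.
  by rewrite !exprS; field.
- rewrite !flat_le0 // mulr0 subr0.
  have cvgF :
      h^-1 *: ((flat m \o shift 0) (h *: 1) - flat m 0) @[h --> 0^'] --> (0 : R).
    (* The difference quotient at 0 is the next member of the family, which tends to 0. *)
    have E h : h^-1 *: ((flat m \o shift 0) (h *: 1) - flat m 0) = flat m.+1 h.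
      rewrite /= addr0 (flat_le0 m (lexx 0)) subr0 /GRing.scale /= mulr1 /flat.
      by case: ifPn => _; [rewrite exprS mulrA|rewrite mulr0].
    under eq_fun do rewrite E.
    exact: cvg_within_filter (flat_continuous0 m.+1).
  apply: DeriveDef; first by apply/cvg_ex; exists 0.
  exact: cvg_lim.
Unshelve. all: by end_near. Qed.

Lemma differentiable_flat m x : differentiable (flat m) x.
Proof. by apply/derivable1_diffP; have [] := is_derive_flat m x. Qed.

Lemma derive_scale1 (f : R -> R) (x v : R) : differentiable f x ->
  'D_v f x = v * 'D_1 f x.
Proof.
move=> df; have := derive_dirP (1 : R) 0 v df.
by rewrite addr0 derive0 addr0 {1}/GRing.scale /= mulr1.
Qed.

Lemma smooth_flat m : smooth_on setT (flat m).
Proof.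
move=> k; elim: k m => [|k IH] m.
  by move=> x _; exact: differentiable_continuous (differentiable_flat m x).
split=> [x _|v]; first exact: differentiable_flat.
have -> : (fun x => 'D_v (flat m) x) =
    fun x => v * (flat m.+2 x + - m%:R * flat m.+1 x).
  apply/funext => x; rewrite (derive_scale1 v (differentiable_flat m x)).
  by have [_ ->] := is_derive_flat m x; rewrite mulNr.
have oT : open (setT : set R) by exact: openT.
apply: (CkM oT (Ck_cst k setT v)); apply: (CkD oT (IH m.+2)).
exact (CkM oT (Ck_cst k setT (- m%:R : R)) (IH m.+1)).
Qed.

End flat_function.

Section bump.
Context {R : realType}.

Lemma CkV {V : normedModType R} k (U : set V) (f : V -> R) : open U ->
  (forall x, U x -> f x != 0) -> Ck k U f -> Ck k U (fun x => (f x)^-1).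
Proof.
move=> oU f0; elim: k => [|k IH] Cf.
  by move=> x Ux; apply: continuousV; [exact: f0|exact: Cf].
have Cf' := CkS Cf; have [df Df] := Cf; split => [x Ux|v].
  by apply: differentiableV; [exact: df|exact: f0].
have CV := IH Cf'.
apply: (Ck_eq oU (f := fun x => (- 1) * (((f x)^-1 * (f x)^-1) * 'D_v f x))).
  move=> x Ux; rewrite deriveV; last exact: diff_derivable (df x Ux).
    by rewrite -exprVn expr2 /GRing.scale /= mulN1r mulNr.
  exact: f0.
apply: (CkM oU (Ck_cst k U (-1 : R))).
exact: (CkM oU (CkM oU CV CV) (Df v)).
Qed.

Lemma Ck_compRR {V : normedModType R} k (U : set V) (f : V -> R) (g : R -> R) :
  open U -> Ck k U f -> smooth_on setT g -> Ck k U (fun x => g (f x)).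
Proof.
move=> oU; elim: k f g => [|k IH] f g Cf sg.
  move=> x Ux; apply: (@continuous_comp _ _ _ f g); first exact: Cf.
  exact: sg 0%N _ I.
have [df Df] := Cf; have dg y : differentiable g y by exact: smooth_differentiable sg I.
split => [x Ux|v].
  by apply: (@differentiable_comp _ _ _ _ f g) => //; exact: df.
apply: (Ck_eq oU (f := fun x => 'D_v f x * 'D_1 g (f x))).
  by move=> x Ux; rewrite (derive_chain v (df x Ux) (dg _)) [RHS]derive_scale1.
apply: (CkM oU (Df v)); apply: (IH f (fun y => 'D_1 g y) (CkS Cf)).
exact: smooth_derive.
Qed.

Lemma Ck_prod {V : normedModType R} k (U : set V) I (r : seq I) (F : I -> V -> R) :
  open U -> (forall i, Ck k U (F i)) -> Ck k U (fun x => \prod_(i <- r) F i x).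
Proof.
move=> oU CF; elim: r => [|i r IH].
  by under eq_fun do rewrite big_nil; exact: Ck_cst.
by under eq_fun do rewrite big_cons; exact: CkM.
Qed.

Definition step (x : R) : R := flat 0 x / (flat 0 x + flat 0 (1 - x)).

(** The numbers x and 1 - x are never both nonpositive. *)
Lemma step_den (x : R) : 0 < flat 0 x + flat 0 (1 - x).
Proof.
have [x0|x0] := ltP 0 x.
  by apply: ltr_wpDr; [exact: flat_ge0|exact: flat_gt0].
apply: ltr_wpDl; first exact: flat_ge0.
by apply: flat_gt0; rewrite subr_gt0; exact: le_lt_trans x0 ltr01.
Qed.

Lemma step_le0 (x : R) : x <= 0 -> step x = 0.
Proof. by move=> x0; rewrite /step (flat_le0 0 x0) mul0r. Qed.

Lemma step_ge1 (x : R) : 1 <= x -> step x = 1.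
Proof.
move=> x1; have := step_den x; rewrite /step (flat_le0 0 (x := 1 - x)) ?subr_le0 //.
by rewrite addr0 => f0; rewrite divff // gt_eqF.
Qed.

Lemma smooth_step : smooth_on setT step.
Proof.
move=> k; have oT : open (setT : set R) by exact: openT.
have Cid : Ck k setT (id : R -> R).
  case: k => [|k]; first by move=> x _; exact: cvg_id.
  split=> [x _|v] //.
  apply: (Ck_eq oT (f := fun=> v)); last exact: Ck_cst.
  by move=> x _; rewrite derive_id.
have C1 : Ck k setT (fun x : R => flat 0 x) by exact: smooth_flat.
have C2 : Ck k setT (fun x : R => flat 0 (1 - x)).
  have CB : Ck k setT (fun x : R => 1 - x).
    exact (CkB oT (Ck_cst k setT (1 : R)) Cid).
  exact (Ck_compRR oT CB (smooth_flat 0)).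
apply: (CkM oT C1); apply: (CkV oT) => [x _|]; first by rewrite gt_eqF // step_den.
exact: (CkD oT C1 C2).
Qed.

Context {n : nat}.

(** For the maximum norm a ball is a cube, so a product over the coordinates replaces a function of
    the norm, which is not smooth in general. With t the rescaled coordinate, each factor is 1 for
    |t| <= 1 and 0 for |t| >= 2. *)
Definition bump (c : 'rV[R]_n) (r : R) (y : 'rV[R]_n) : R :=
  \prod_(j < n) (step (2 - r^-1 * (y 0 j - c 0 j)) *
                 step (2 + r^-1 * (y 0 j - c 0 j))).

Lemma smooth_bump c r (U : set 'rV[R]_n) : open U -> smooth_on U (bump c r).
Proof.
move=> oU k; apply: Ck_prod => // j.
have Cj : Ck k U (fun y : 'rV[R]_n => r^-1 * (y 0 j - c 0 j)).
  apply: (CkM oU (Ck_cst k U r^-1)).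
  exact: (CkB oU (@Ck_coord _ k _ U j) (Ck_cst k U (c 0 j : R))).
have C2 := Ck_cst k U (2 : R).
apply: (CkM oU).
  by apply: (Ck_compRR oU _ smooth_step); exact: (CkB oU C2 Cj).
by apply: (Ck_compRR oU _ smooth_step); exact: (CkD oU C2 Cj).
Qed.

Lemma bump_eq1 c r y : 0 < r -> `|c - y| <= r -> bump c r y = 1.
Proof.
move=> r0 cy; apply: big1 => j _.
have : `|r^-1 * (y 0 j - c 0 j)| <= 1.
  rewrite normrM gtr0_norm ?invr_gt0 // mulrC ler_pdivrMr // mul1r.
  rewrite distrC; apply: le_trans cy.
  have /= := le_bigmax 0 (fun ij => `|(c - y) ij.1 ij.2|) (0, j).
  by rewrite [in X in _ -> X]/Num.norm /= mx_normrE !mxE.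
rewrite ler_norml => /andP[l1 l2]; rewrite !step_ge1 ?mulr1 //; lra.
Qed.

Lemma bump_eq0 c r y : 0 < r -> 2 * r < `|c - y| -> bump c r y = 0.
Proof.
move=> r0; rewrite {1}/Num.norm /= mx_normrE => /bigmax_gtP[|[[i j] _ /=]].
  by rewrite pmulr_rlt0 // ltNge (ltW r0).
rewrite (ord1 i) !mxE -normrN opprB => cy; rewrite /bump (bigD1 j) //=.
set t := r^-1 * _.
have : 2 < `|t|.
  by rewrite normrM gtr0_norm ?invr_gt0 // mulrC ltr_pdivlMr.
rewrite lter_normr => /orP[t2|t2].
  by rewrite (step_le0 (x := 2 - t)) ?mul0r ?subr_le0 // ltW.
rewrite (step_le0 (x := 2 + t)) ?mulr0 ?mul0r //; lra.
Qed.

End bump.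

Section cutoff.
Context {R : realType} {n : nat} {M : manifold R n}.
Implicit Types (i j : chart_index M) (x : M) (f : M -> R).

(** The set [K] is closed in all of M, not merely in the chart domain: this makes the extension by
    zero of fields defined on [dom i] smooth. *)
Definition cutoff i f : Prop :=
  smooth_function f /\
  exists K : set M, [/\ closed K, K `<=` dom i & forall z, ~ K z -> f z = 0].

Lemma chart_preimage_open i (Q : set 'rV[R]_n) : open Q ->
  open (dom i `&` chart i @^-1` Q).
Proof.
move=> oQ; apply: open_preimage_on => //; first exact: dom_open.
by move=> x; exact: chart_continuous.
Qed.

Lemma cutoff_exists i x : dom i x ->
  exists f W, [/\ cutoff i f, open W, W x & forall z, W z -> f z = 1].
Proof.
move=> di; have ocod : open (cod i) by exact: chart_open.
set c := chart i x; have cc : cod i c by exact: dom_cod.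
have [e /= e0 eP] := (nbhs_ballP _ _).1 (open_nbhs_nbhs (conj ocod cc)).
(* The bump vanishes beyond distance 2 r, and the closed ball of radius 2 r = 2 e / 3 lies in the
   ball of radius [e]. *)
pose r := e / 3; have r0 : 0 < r by rewrite divr_gt0.
pose B := closed_ball_ (fun z : 'rV[R]_n => `|z|) c (2 * r).
have BE : B = closed_ball c (2 * r) by rewrite closed_ballE // mulr_gt0.
have Bcod : B `<=` cod i.
  move=> y; rewrite /B /closed_ball_ /= => cy; apply: eP; rewrite -ball_normE /=.
  apply: le_lt_trans cy _; rewrite /r; lra.
have cB : compact B.
  apply: bounded_closed_compact; last by rewrite BE; exact: closed_ball_closed.
  exists (`|c| + 2 * r); split; first exact: num_real.
  move=> m cm y; rewrite /B /closed_ball_ /= => cy.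
  rewrite -(subrK c y); apply: le_trans (ler_normD _ _) _; rewrite distrC addrC.
  by apply: le_trans (ltW cm); rewrite lerD2l.
pose K := param i @` B.
(* The image of a compact ball is compact, hence closed because M is Hausdorff. *)
have cK : closed K.
  apply: compact_closed; first exact: space_hausdorff.
  apply: continuous_compact => //; apply: continuous_in_subspaceT => y.
  by rewrite inE => /Bcod; exact: param_continuous.
have Kdom : K `<=` dom i by move=> _ [y /Bcod cy <-]; exact: cod_dom.
pose f z : R := if pselect (dom i z) then bump c r (chart i z) else 0.
have f0 z : ~ K z -> f z = 0.
  rewrite /f; case: pselect => // dz Kz; apply: bump_eq0 => //.
  rewrite ltNge; apply/negP => cz; apply: Kz; exists (chart i z) => //.
  exact: chartK.
have fE z : dom i z -> f z = bump c r (chart i z).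
  by move=> dz; rewrite /f; case: pselect.
exists f, (dom i `&` chart i @^-1` ball c r); split.
- split; last by exists K.
  move=> j k; apply: Ck_local => y cy.
  (* On [dom i] the function is a bump composed with a transition map; a point outside [dom i] has
     the complement of [K] as a neighbourhood, where the function is zero. *)
  have [dy|ndy] := pselect (dom i (param j y)).
    exists (overlap j i); split; first exact: overlap_open.
      by rewrite overlapE.
    apply: (@Ck_eq _ _ _ _ _ (fun z => bump c r (trans j i z))).
      exact: overlap_open.
      by move=> z oz /=; rewrite fE //; have [] := overlap_dom oz.
    have oO := @overlap_open _ _ M j i.
    have oc : overlap j i `<=` cod j by move=> z; exact: overlap_cod.
    exact (Ck_compR oO ocod (fun z oz => overlap_cod (trans_overlap oz))
      (trans_smooth j i k) (smooth_bump c r ocod k)).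
  have oP : open (cod j `&` param j @^-1` ~` K).
    by apply: open_cod_param; exact: closed_openC.
  exists (cod j `&` param j @^-1` ~` K); split => //.
    by split => // /Kdom.
  apply: (@Ck_eq _ _ _ _ _ (fun=> 0)) => //; last exact: Ck_cst.
  by move=> z [_ /f0].
- by apply: chart_preimage_open; exact: ball_open.
- by split => //; exact: ballxx.
- move=> z [dz]; rewrite -ball_normE /= => cz.
  by rewrite fE // bump_eq1 // ltW.
Qed.

Lemma cutoff_field i f (Z : M -> 'rV[R]_n) : cutoff i f ->
  smooth_on (cod i) (local_field i Z) -> smooth_field (fun z => f z *: Z z).
Proof.
move=> [sf [K [cK Kdom f0]]] sZ; apply: smooth_field_local => x.
have [dx|ndx] := pselect (dom i x).
  exists i, (cod i); split => //; [exact: chart_open|exact: dom_cod|].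
  move=> k; have oc : open (cod i) by exact: chart_open.
  apply: (Ck_eq oc (f := fun y => f (param i y) *: local_field i Z y)).
    by move=> y cy; rewrite /local_field (linZ (dchart_linear i _)).
  exact: (CkZ oc (sf i k) (sZ k)).
have oP : open (cod (chart_at x) `&` param (chart_at x) @^-1` ~` K).
  by apply: open_cod_param; exact: closed_openC.
have dc := chart_atP x.
exists (chart_at x), (cod (chart_at x) `&` param (chart_at x) @^-1` ~` K); split => //.
  by split; [exact: dom_cod|rewrite /= chartK // => /Kdom].
move=> k; apply: (Ck_eq oP (f := fun=> 0)); last exact: Ck_cst.
by move=> y [_ /f0 fy]; rewrite /local_field fy scale0r (lin0 (dchart_linear _ _)).
Qed.

(** A field with constant components in the chart at [x], multiplied by a cutoff. It makes pointwise
    information available from statements about global fields. *)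
Lemma field_through x v : exists2 X : M -> 'rV[R]_n, smooth_field X & X x = v.
Proof.
set i := chart_at x; have di : dom i x by exact: chart_atP.
have [f [W [cf oW Wx f1]]] := cutoff_exists di.
exists (fun z => f z *: dparam i z v).
  apply: (cutoff_field cf) => k; have oc : open (cod i) by exact: chart_open.
  apply: (Ck_eq oc (f := fun=> v)); last exact: Ck_cst.
  by move=> y cy; rewrite /local_field dparamK //; exact: cod_dom.
by rewrite f1 // scale1r; exact: diff_transition_id (dom_cod di).
Qed.

End cutoff.

(** * Existence of minimal connections *)

Section partition.
Context {R : realType} {n : nat} {M : manifold R n}.

(** Every point has a cutoff that is 1 on a whole basic open neighbourhood. Choosing one cutoff for
    each basic set that admits one leaves a countable family, indexed by the codes of the sets. *)
Lemma countable_cutoffs (x0 : M) :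
  exists (f : nat -> M -> R) (i : nat -> chart_index M),
    (forall k, cutoff (i k) (f k)) /\
    forall x, exists m W, [/\ open W, W x & forall z, W z -> f m z = 1].
Proof.
have [B /countable_injP[g ginj] [oB basisB]] := @space_second_countable _ _ M.
pose P k (p : chart_index M * (M -> R)) := cutoff p.1 p.2 /\
  exists b, [/\ B b, g b = k & forall z, b z -> p.2 z = 1].
(* Codes without a suitable basic set receive the zero function, with the chart at [x0] as a dummy
   index. *)
pose d k : chart_index M * (M -> R) :=
  if pselect (exists p, P k p) is left h then projT1 (cid h)
  else (chart_at x0, fun=> 0).
have dP k : (exists p, P k p) -> P k (d k).
  by rewrite /d; case: pselect => // h _; exact: projT2 (cid h).
exists (fun k => (d k).2), (fun k => (d k).1); split => [k|x].
  have [/dP[]//|nP] := pselect (exists p, P k p).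
  rewrite /d; case: pselect => // _; split; last first.
    by exists set0; split => //; exact: closed0.
  by move=> i j; exact: Ck_cst.
have [f [W [cf oW Wx f1]]] := cutoff_exists (chart_atP x).
have [b [Bb bx] bW] := basisB _ _ (open_nbhs_nbhs (conj oW Wx)).
have : exists p, P (g b) p.
  by exists (chart_at x, f); split => //; exists b; split => // z /bW /f1.
move=> /dP[_ [b' [Bb' gb' f'1]]].
have bb' : b' = b by apply: ginj => //; exact/mem_set.
by exists (g b), b; split => // [|z bz]; [exact: oB|apply: f'1; rewrite bb'].
Qed.

Variables (f : nat -> M -> R) (i : nat -> chart_index M).
Hypothesis cf : forall k, cutoff (i k) (f k).
Hypothesis f_cover : forall x, exists m W,
  [/\ open W, W x & forall z, W z -> f m z = 1].

(* Where [f m] is 1 all the weights of index larger than [m] vanish: this makes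
   the family locally finite, with sum 1, without any paracompactness. *)
Definition weight k (x : M) : R := f k x * \prod_(l < k) (1 - f l x).

Lemma weight_eq0 m k x : f m x = 1 -> (m < k)%N -> weight k x = 0.
Proof.
move=> fm mk; rewrite /weight (bigD1 (Ordinal mk)) //= fm subrr.
by rewrite mul0r mulr0.
Qed.

Lemma weight_dom k x : ~ dom (i k) x -> weight k x = 0.
Proof.
have [_ [K [_ Kd f0]]] := cf k; move=> nd.
by rewrite /weight f0 ?mul0r // => /Kd.
Qed.

(** A telescoping sum: each weight is the difference of two consecutive products. *)
Lemma sum_weight m x : \sum_(k < m) weight k x = 1 - \prod_(k < m) (1 - f k x).
Proof.
elim: m => [|m IH]; first by rewrite !big_ord0 subrr.
by rewrite !big_ord_recr /= IH /weight; ring.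
Qed.

Lemma weight_cutoff k : cutoff (i k) (weight k).
Proof.
have [sf [K [cK Kd f0]]] := cf k; split; last first.
  by exists K; split => // z /f0; rewrite /weight => ->; rewrite mul0r.
move=> j p; have oc : open (cod j) by exact: chart_open.
apply: (CkM oc (sf j p)); apply: Ck_prod => // l.
apply: (CkB oc (Ck_cst p (cod j) (1 : R))).
by have [+ _] := cf l; exact.
Qed.

Lemma f_cover1 x : exists m, f m x = 1.
Proof. by have [m [W [_ Wx f1]]] := f_cover x; exists m; exact: f1. Qed.

(** The successor includes the chosen index itself, beyond which the weights at [x] vanish. By
    [glueE] the choice does not matter. *)
Definition glue_bound x : nat := (projT1 (cid (f_cover1 x))).+1.

Definition glue (T : nat -> M -> 'rV[R]_n) (x : M) : 'rV[R]_n :=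
  \sum_(k < glue_bound x) weight k x *: T k x.

Lemma sum_weight_truncate (T : nat -> M -> 'rV[R]_n) m N x : f m x = 1 ->
  (m < N)%N ->
  \sum_(k < N) weight k x *: T k x = \sum_(k < m.+1) weight k x *: T k x.
Proof.
move=> fm mN; rewrite -(subnKC mN) big_split_ord /= [X in _ + X]big1 ?addr0 //.
by move=> k _; rewrite (weight_eq0 fm) ?scale0r // /= addSn ltnS leq_addr.
Qed.

Lemma glueE T m x : f m x = 1 ->
  glue T x = \sum_(k < m.+1) weight k x *: T k x.
Proof.
move=> fm; rewrite /glue /glue_bound; case: cid => m' fm' /=.
have mN : (m < (maxn m m').+1)%N by rewrite ltnS leq_maxl.
have m'N : (m' < (maxn m m').+1)%N by rewrite ltnS leq_maxr.
by rewrite -(sum_weight_truncate T fm' m'N) -(sum_weight_truncate T fm mN).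
Qed.

(** The two-term form covers additivity, homogeneity, the Leibniz rule and the torsion identity
    alike. The relation is required only where the chart is defined, since elsewhere the weight is
    0. *)
Lemma glue_linear (T T1 T2 : nat -> M -> 'rV[R]_n) (a b : R) x :
  (forall k, dom (i k) x -> T k x = a *: T1 k x + b *: T2 k x) ->
  glue T x = a *: glue T1 x + b *: glue T2 x.
Proof.
move=> TE; rewrite /glue !scaler_sumr -big_split; apply: eq_bigr => k _ /=.
have [dk|/weight_dom ->] := pselect (dom (i k) x); last first.
  by rewrite !scale0r !scaler0 addr0.
by rewrite TE // scalerDr !scalerA; congr (_ *: _ + _ *: _); rewrite mulrC.
Qed.

Lemma glue_cst (T : nat -> M -> 'rV[R]_n) v x :
  (forall k, dom (i k) x -> T k x = v) -> glue T x = v.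
Proof.
move=> TE; have [m fm] := f_cover1 x; rewrite (glueE T fm).
transitivity ((\sum_(k < m.+1) weight k x) *: v).
  rewrite scaler_suml; apply: eq_bigr => k _.
  by have [/TE ->|/weight_dom ->] := pselect (dom (i k) x); rewrite ?scale0r.
by rewrite sum_weight (bigD1 ord_max) //= fm subrr mul0r subr0 scale1r.
Qed.

Lemma smooth_field_sum N (T : nat -> M -> 'rV[R]_n) :
  (forall k, smooth_field (T k)) -> smooth_field (fun x => \sum_(k < N) T k x).
Proof.
move=> sT j p; have oc : open (cod j) by exact: chart_open.
apply: (Ck_eq oc (f := fun y => \sum_(k < N) local_field j (T k) y)).
  by move=> y _; rewrite /local_field /dchart linear_sum.
by apply: Ck_sum => // k; exact: sT.
Qed.

(** The number of terms depends on the point, but on the open set [W] where [f m] is 1 the same m +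
    1 terms serve throughout. *)
Lemma smooth_glue (T : nat -> M -> 'rV[R]_n) :
  (forall k, smooth_on (cod (i k)) (local_field (i k) (T k))) ->
  smooth_field (glue T).
Proof.
move=> sT; apply: smooth_field_local => x.
have [m [W [oW Wx f1]]] := f_cover x; set j := chart_at x.
have sS : smooth_field (fun x => \sum_(k < m.+1) weight k x *: T k x).
  apply: (@smooth_field_sum m.+1 (fun k x => weight k x *: T k x)) => k.
  exact: cutoff_field (weight_cutoff k) (sT k).
have oP : open (cod j `&` param j @^-1` W) by exact: open_cod_param.
have dx : dom j x by exact: chart_atP.
exists j, (cod j `&` param j @^-1` W); split => //.
  by split; [exact: dom_cod|rewrite /= chartK].
move=> p; apply: (Ck_eq oP (f := local_field j (fun x =>
    \sum_(k < m.+1) weight k x *: T k x))).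
  by move=> y [_ Wy]; rewrite /local_field (glueE _ (f1 _ Wy)).
have PC : cod j `&` param j @^-1` W `<=` cod j by move=> y [].
exact (Ck_subset PC (sS j p)).
Qed.

End partition.

HB.lock Definition dir_derive {R : realType} {n : nat}
    (X Y : 'rV[R]_n -> 'rV[R]_n) (y : 'rV[R]_n) : 'rV[R]_n := 'D_(X y) Y y.

Lemma dir_deriveE {R : realType} {n : nat} (X Y : 'rV[R]_n -> 'rV[R]_n) y :
  dir_derive X Y y = 'D_(X y) Y y.
Proof. by rewrite dir_derive.unlock. Qed.

Section smooth_fields.
Context {R : realType} {n : nat} {M : manifold R n}.
Implicit Types (X Y : M -> 'rV[R]_n) (f : M -> R) (i : chart_index M).

Lemma local_fieldD i X Y : local_field i (fun x => X x + Y x) =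
  fun y => local_field i X y + local_field i Y y.
Proof. by apply/funext => y; rewrite /local_field (linD (dchart_linear i _)). Qed.

Lemma local_fieldZ i f X : local_field i (fun x => f x *: X x) =
  fun y => f (param i y) *: local_field i X y.
Proof. by apply/funext => y; rewrite /local_field (linZ (dchart_linear i _)). Qed.

Lemma smooth_function_cst (a : R) : smooth_function (fun _ : M => a).
Proof. by move=> i k; exact: Ck_cst. Qed.

Lemma smooth_fieldD X Y : smooth_field X -> smooth_field Y ->
  smooth_field (fun x => X x + Y x).
Proof.
move=> sX sY i k; rewrite local_fieldD.
by apply: CkD; [exact: chart_open|exact: sX|exact: sY].
Qed.

Lemma smooth_fieldZ f X : smooth_function f -> smooth_field X ->
  smooth_field (fun x => f x *: X x).
Proof.
move=> sf sX i k; rewrite local_fieldZ.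
by apply: CkZ; [exact: chart_open|exact: sf|exact: sX].
Qed.

Lemma smooth_fieldB X Y : smooth_field X -> smooth_field Y ->
  smooth_field (fun x => X x - Y x).
Proof.
move=> sX sY; have := smooth_fieldD sX (smooth_fieldZ (smooth_function_cst (-1)) sY).
by rewrite (_ : (fun x => X x + _) = fun x => X x - Y x) //; apply/funext => x;
  rewrite scaleN1r.
Qed.

Lemma dparam_local_field i X x : dom i x ->
  dparam i x (local_field i X (chart i x)) = X x.
Proof. by move=> di; rewrite local_field_dom // dchartK. Qed.

Section flat_connection.
Variable i : chart_index M.

(** The flat connection for which the coordinate fields of the chart [i] are parallel; it is
    meaningful on [dom i] only. *)
Definition flat_conn X Y (x : M) : 'rV[R]_n :=
  dparam i x (dir_derive (local_field i X) (local_field i Y) (chart i x)).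

Lemma local_flat_conn X Y y : cod i y -> local_field i (flat_conn X Y) y =
  dir_derive (local_field i X) (local_field i Y) y.
Proof.
by move=> cy; rewrite /local_field /flat_conn paramK // dparamK //; exact: cod_dom.
Qed.

Lemma smooth_flat_conn X Y : smooth_field X -> smooth_field Y ->
  smooth_on (cod i) (local_field i (flat_conn X Y)).
Proof.
move=> sX sY k; have oc : open (cod i) by exact: chart_open.
apply: (Ck_eq oc (f := fun y => 'D_(local_field i X y) (local_field i Y) y)).
  by move=> y cy; rewrite local_flat_conn // dir_deriveE.
apply: (Ck_pairing (B := fun y u => 'D_u (local_field i Y) y) oc _ _ (sX i k)).
  by move=> y cy; exact (derive_dir_linear (sY i) cy).
by move=> u; exact: smooth_derive (sY i) k.
Qed.

Variables (x : M) (di : dom i x).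
Let cy : cod i (chart i x) := dom_cod di.

Lemma flat_connDl X X' Y : smooth_field Y ->
  flat_conn (fun x => X x + X' x) Y x = flat_conn X Y x + flat_conn X' Y x.
Proof.
move=> sY; rewrite /flat_conn -(linD (dparam_linear i x)); congr (dparam _ _ _).
rewrite local_fieldD !dir_deriveE; exact: linD (derive_dir_linear (sY i) cy) _ _.
Qed.

Lemma flat_connZl f X Y : smooth_field Y ->
  flat_conn (fun x => f x *: X x) Y x = f x *: flat_conn X Y x.
Proof.
move=> sY; rewrite /flat_conn -(linZ (dparam_linear i x)); congr (dparam _ _ _).
rewrite local_fieldZ !dir_deriveE chartK //.
exact: linZ (derive_dir_linear (sY i) cy) _ _.
Qed.

Lemma flat_connDr X Y Y' : smooth_field Y -> smooth_field Y' ->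
  flat_conn X (fun x => Y x + Y' x) x = flat_conn X Y x + flat_conn X Y' x.
Proof.
move=> sY sY'; rewrite /flat_conn -(linD (dparam_linear i x)); congr (dparam _ _ _).
rewrite local_fieldD !dir_deriveE.
exact: deriveD (diff_derivable (smooth_field_diff sY cy))
  (diff_derivable (smooth_field_diff sY' cy)).
Qed.

Lemma flat_conn_leibniz f X Y : smooth_function f -> smooth_field Y ->
  flat_conn X (fun x => f x *: Y x) x =
  field_derive X f x *: Y x + f x *: flat_conn X Y x.
Proof.
move=> sf sY; have lp := dparam_linear i x.
have E : dir_derive (local_field i X) (local_field i (fun x => f x *: Y x))
    (chart i x) = field_derive X f x *: local_field i Y (chart i x)
    + f x *: dir_derive (local_field i X) (local_field i Y) (chart i x).
  rewrite local_fieldZ !dir_deriveE (field_derive_chart X sf di).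
  rewrite (deriveZv _ (smooth_function_diff sf cy) (smooth_field_diff sY cy)).
  by rewrite chartK.
rewrite {1}/flat_conn E (linD lp) !(linZ lp) dparam_local_field //.
Qed.

Lemma flat_conn_torsion X Y : smooth_field X -> smooth_field Y ->
  flat_conn X Y x - flat_conn Y X x = lie_bracket X Y x.
Proof.
move=> sX sY; rewrite -(linB (dparam_linear i x)) !dir_deriveE -chart_bracketE.
by rewrite -(lie_bracket_chart sX sY di) dchartK.
Qed.

End flat_connection.

Definition torsion_free (D : @linear_connection R n M) : Prop :=
  forall X Y, smooth_field X -> smooth_field Y ->
  forall x, D X Y x - D Y X x = lie_bracket X Y x.

Lemma torsion_free_exists : exists D : @linear_connection R n M, torsion_free D.
Proof.
(* The family of cutoffs is indexed with the help of a point, so the empty manifold is treated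
   apart; there every pointwise claim is vacuous. *)
have [[x0 _]|noM] := pselect (exists x : M, True); last first.
  have H (P : M -> Prop) x : P x by case: noM; exists x.
  have sm (X : M -> 'rV[R]_n) : smooth_field X.
    move=> i k; apply: Ck_local => y _.
    exact: (H (fun _ => exists U', _) (param i y)).
  have @D : @linear_connection R n M.
    by apply: (@LinearConnection _ _ _ (fun _ _ _ => 0)) => // *;
      exact: (H (fun _ => _)).
  by exists D => X Y _ _ x; exact: (H (fun _ => _) x).
have [f [i [cf fc]]] := countable_cutoffs x0.
pose T X Y k := flat_conn (i k) X Y.
have lin := glue_linear cf fc.
have @D : @linear_connection R n M.
  apply: (@LinearConnection _ _ _ (fun X Y => glue fc (T X Y))) => [X Y sX sY|
    X X' Y sX sX' sY x|g X Y sg sX sY x|X Y Y' sX sY sY' x|g X Y sg sX sY x].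
  - by apply: (smooth_glue cf) => k; exact: smooth_flat_conn.
  - rewrite -[glue _ (T X Y) x]scale1r -[glue _ (T X' Y) x]scale1r.
    by apply: lin => k dk; rewrite !scale1r; exact: flat_connDl.
  (* A second summand with coefficient 0 gives the two-term form of [glue_linear]. *)
  - rewrite -[RHS]addr0 -[X in _ = _ + X](scale0r (glue fc (T X Y) x)).
    by apply: lin => k dk; rewrite scale0r addr0; exact: flat_connZl.
  - rewrite -[glue _ (T X Y) x]scale1r -[glue _ (T X Y') x]scale1r.
    by apply: lin => k dk; rewrite !scale1r; exact: flat_connDr.
  (* As the weights sum to 1, [Y] is itself a glued family, and the Leibniz rule becomes a two-term
     combination in each chart. *)
  - rewrite -[X in _ = _ *: X + _](glue_cst (x := x) cf fc (T := fun _ => Y)) //.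
    by apply: lin => k dk; exact: flat_conn_leibniz.
exists D => X Y sX sY x /=.
rewrite -[RHS](glue_cst (x := x) cf fc
  (T := fun k x => T X Y k x - T Y X k x)); last first.
  by move=> k dk; exact: flat_conn_torsion.
rewrite -[in LHS]scaleN1r -[X in X + _ = _]scale1r; symmetry.
by apply: (glue_linear cf fc) => k dk; rewrite scale1r scaleN1r.
Qed.

End smooth_fields.

(** * The correction that makes a torsion free connection minimal *)

Section minimal_algebra.
Context {R : realType} {n : nat}.
Variable J : 'rV[R]_n -> 'rV[R]_n.
Hypotheses (lJ : linear J) (J2 : forall w, J (J w) = - w).
Implicit Types a b p q r : 'rV[R]_n.

(** The letters stand for D_X Y, D_Y X, D_{JY} JX, D_{JY} X, D_Y JX and D_X JY, in this order. The
    first half averages D into a connection preserving J; the second adjusts its torsion. *)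
Definition minimal_comb a b p q r r' : 'rV[R]_n :=
  2^-1 *: (a - J r') - 4^-1 *: (p - J q + J r + b).

(** The left side is the combination for JY in place of Y: since JJY = - Y, the substitution
    permutes the six letters up to sign. *)
Lemma minimal_comb_complex a b p q r r' :
  minimal_comb r' q (- r) (- b) p (- a) = J (minimal_comb a b p q r r').
Proof.
rewrite /minimal_comb !(linD lJ, linN lJ, linZ lJ) !J2.
by apply/rowP => j; rewrite !mxE; field.
Qed.

(** Primes mark the exchange of X and Y. For a torsion free D the differences p' - p, q' - r, r' - q
    and a - b are the four brackets of the Nijenhuis tensor. *)
Lemma minimal_comb_torsion a b p p' q q' r r' :
  minimal_comb a b p q r r' - minimal_comb b a p' q' r' r - (a - b) =
  4^-1 *: (p' - p - J (q' - r) - J (r' - q) - (a - b)).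
Proof.
rewrite /minimal_comb !(linD lJ, linN lJ).
by apply/rowP => j; rewrite !mxE; field.
Qed.

End minimal_algebra.

Section minimal_connection.
Context {R : realType} {n : nat} {M : manifold R n}.
Variables (J : almost_complex_structure M) (D : @linear_connection R n M).
Implicit Types (X Y : M -> 'rV[R]_n) (f : M -> R) (x : M).

(* D - Q, with 4 Q(X, Y) = (D_{JY} J) X + J (D_Y J) X + 2 J (D_X J) Y. *)
Definition minimal_nabla X Y x : 'rV[R]_n :=
  let JX := acs_field J X in let JY := acs_field J Y in
  minimal_comb (J x) (D X Y x) (D Y X x) (D JY JX x) (D JY X x) (D Y JX x)
    (D X JY x).

Lemma acs_fieldD X Y : acs_field J (fun x => X x + Y x) =
  fun x => acs_field J X x + acs_field J Y x.
Proof. by apply/funext => x; rewrite /acs_field linearD. Qed.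

Lemma acs_fieldZ f X : acs_field J (fun x => f x *: X x) =
  fun x => f x *: acs_field J X x.
Proof. by apply/funext => x; rewrite /acs_field linearZ. Qed.

Lemma acs_fieldK X : acs_field J (acs_field J X) = fun x => (-1) *: X x.
Proof. by apply/funext => x; rewrite /acs_field acs_square scaleN1r. Qed.

Lemma field_derive_cst X (a : R) x : field_derive X (fun=> a) x = 0.
Proof.
rewrite /field_derive (_ : _ \o _ = fun=> a) ?derive_cst //.
Qed.

Lemma nablaNl X Y x : smooth_field X -> smooth_field Y ->
  D (fun x => (-1) *: X x) Y x = - D X Y x.
Proof.
move=> sX sY; rewrite -[RHS]scaleN1r.
exact (nablaZl D (smooth_function_cst (-1 : R)) sX sY x).
Qed.

Lemma nablaNr X Y x : smooth_field X -> smooth_field Y ->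
  D X (fun x => (-1) *: Y x) x = - D X Y x.
Proof.
move=> sX sY.
have := nabla_leibniz D (smooth_function_cst (-1)) sX sY x.
by rewrite field_derive_cst scale0r add0r scaleN1r.
Qed.

Lemma minimal_nabla_smooth X Y : smooth_field X -> smooth_field Y ->
  smooth_field (minimal_nabla X Y).
Proof.
move=> sX sY; have sJ := @smooth_acs_field _ _ _ J.
have [sJX sJY] := (sJ _ sX, sJ _ sY).
have sD A B : smooth_field A -> smooth_field B -> smooth_field (D A B).
  exact: nabla_smooth.
have sc (a : R) A : smooth_field A -> smooth_field (fun x => a *: A x).
  exact: smooth_fieldZ (smooth_function_cst a).
apply: smooth_fieldB; apply: sc.
  by apply: smooth_fieldB; [|apply: sJ]; exact: sD.
apply: smooth_fieldD; last exact: sD.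
apply: smooth_fieldD; last by apply: sJ; exact: sD.
by apply: smooth_fieldB; [|apply: sJ]; exact: sD.
Qed.

Lemma minimal_connection_of : torsion_free D ->
  exists D' : @linear_connection R n M, minimal_connection J D'.
Proof.
move=> tD; have sJ := @smooth_acs_field _ _ _ J.
have @D' : @linear_connection R n M.
  apply: (@LinearConnection _ _ _ minimal_nabla) => [X Y sX sY|
    X X' Y sX sX' sY x|f X Y sf sX sY x|X Y Y' sX sY sY' x|f X Y sf sX sY x].
  - exact: minimal_nabla_smooth.
  - have [sJX sJX' sJY] := And3 (sJ _ sX) (sJ _ sX') (sJ _ sY).
    rewrite /minimal_nabla /minimal_comb acs_fieldD !nablaDl // !nablaDr // !linearD /=.
    by apply/rowP => j; rewrite !mxE; ring.
  (* Differentiating f X along Y and JY produces derivatives of f, which cancel in pairs because J^2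
     = -1. *)
  - have [sJX sJY] := (sJ _ sX, sJ _ sY).
    rewrite /minimal_nabla /minimal_comb acs_fieldZ !nablaZl // !nabla_leibniz //.
    rewrite !linearD !linearZ /= !acs_square.
    by apply/rowP => j; rewrite !mxE; ring.
  - have [sJX sJY sJY'] := And3 (sJ _ sX) (sJ _ sY) (sJ _ sY').
    rewrite /minimal_nabla /minimal_comb acs_fieldD !nablaDl // !nablaDr // !linearD /=.
    by apply/rowP => j; rewrite !mxE; ring.
  (* The derivative of f along X occurs with coefficient 1/2 both in D_X Y and in - J D_X JY; the
     two add up to the Leibniz term. *)
  - have [sJX sJY] := (sJ _ sX, sJ _ sY).
    rewrite /minimal_nabla /minimal_comb acs_fieldZ !nablaZl // !nabla_leibniz //.
    rewrite !linearD !linearZ /= !acs_square.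
    by apply/rowP => j; rewrite !mxE; field.
exists D'; split => X Y sX sY x /=; have [sJX sJY] := (sJ _ sX, sJ _ sY).
  rewrite /minimal_nabla acs_fieldK !nablaNl // nablaNr //.
  exact: (minimal_comb_complex (J := J x) (linearP _) (acs_square J x)).
rewrite /torsion /nijenhuis -!tD //.
exact: (minimal_comb_torsion (J := J x) (linearP _)).
Qed.

End minimal_connection.

(** * The structure on the tangent bundle *)

Section integrable_in_charts.
Context {R : realType} {n : nat}.

Lemma dacs_eq (U : set 'rV[R]_n) (A A' : 'rV[R]_n -> 'rV[R]_n -> 'rV[R]_n) y v w :
  open U -> (forall y w, U y -> A y w = A' y w) -> U y ->
  dacs A y v w = dacs A' y v w.
Proof.
move=> oU AA' Uy; rewrite !dacsE.
exact: derive_eq_on oU (fun z Uz => AA' z w Uz) Uy.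
Qed.

Lemma lnij_eq (U : set 'rV[R]_n) (A A' : 'rV[R]_n -> 'rV[R]_n -> 'rV[R]_n) y v w :
  open U -> (forall y w, U y -> A y w = A' y w) -> U y ->
  lnij A y v w = lnij A' y v w.
Proof.
move=> oU AA' Uy; have dE := dacs_eq _ _ oU AA' Uy.
by rewrite /lnij /nij !(AA' y _ Uy) !dE.
Qed.

Context {M : manifold R n}.

Lemma local_J_at (J : almost_complex_structure M) (x : M) w :
  local_J J (chart_at x) (chart (chart_at x) x) w = J x w.
Proof.
by rewrite -[in LHS](dchart_at x w) -(local_J_dom _ _ (chart_atP x)) dchart_at.
Qed.

(** By tensoriality it is enough to test on global fields through given vectors, which
    [field_through] provides. *)
Lemma integrable_charts (J : almost_complex_structure M) :
  integrable J <->
  forall (i : chart_index M) y v w, cod i y -> lnij (local_J J i) y v w = 0.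
Proof.
split=> [iJ i y v w cy|N0 X Y sX sY x]; last first.
  rewrite -(dchart_at x (nijenhuis J X Y x)) (nijenhuis_chart J sX sY (chart_atP x)).
  exact/N0/dom_cod/chart_atP.
set x := param i y; have di : dom i x by exact: cod_dom.
have [X sX Xx] := field_through x (dparam i x v).
have [Y sY Yx] := field_through x (dparam i x w).
have := nijenhuis_chart J sX sY di.
rewrite (iJ X Y sX sY x) (lin0 (dchart_linear i x)) !(local_field_dom _ di).
by rewrite Xx Yx !(dparamK _ di) /x (paramK cy) => <-.
Qed.

End integrable_in_charts.

Section tangent_structure.
Context {R : realType} {n : nat} {M : manifold R n}.
Variable J : almost_complex_structure M.
Notation TM := (tangent_manifold M).
Notation tcod := (@cod R (n + n) TM).
Notation ttrans := (@trans R (n + n) TM).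
Notation tdchart := (@dchart R (n + n) TM).
Notation tdparam := (@dparam R (n + n) TM).
Implicit Types (a : TM) (i j : chart_index M) (z : 'rV[R]_(n + n)).

Let hJ i : local_acs (hat_dom (cod i)) (hat (local_J J i)) :=
  hat_local_acs (local_J_acs J i).

(** The two chart choices are made from proofs of the same existence statement, so proof irrelevance
    identifies them. *)
Lemma chart_at_base a : chart_at a = chart_at (base a) :> chart_index M.
Proof.
by rewrite /chart_at; congr (projT1 (cid _)); exact: Prop_irrelevance.
Qed.

Lemma tcod_hat_dom i : tcod i = hat_dom (cod i).
Proof. exact: tcodE. Qed.

Lemma ttrans_tau_hat i j z : overlap i j (lsubmx z) ->
  ttrans i j z = tau_hat (trans i j) z.
Proof.
move=> o; rewrite /tau_hat (derive_trans _ o).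
by [].
Qed.

Lemma chart_tchart i a : @chart R (n + n) TM i a = tchart i a. Proof. by []. Qed.

(** An instance of [hat_change] on the overlap of the two charts, where the tangent map of the
    transition map of M is the transition map of TM. *)
Lemma hat_dchart c i a u : tdom c a -> tdom i a ->
  hat (local_J J i) (tchart i a) ('D_u (ttrans c i) (tchart c a)) =
  'D_(hat (local_J J c) (tchart c a) u) (ttrans c i) (tchart c a).
Proof.
move=> ac ai; set z := tchart c a.
have lz : lsubmx z = chart c (base a) by exact: row_mxKl.
have o : overlap c i (lsubmx z) by rewrite lz; exact: overlap_chart.
have oO := @overlap_open _ _ M c i.
have oh : open (hat_dom (overlap c i)) by exact: open_lsubmx.
have E v : 'D_v (ttrans c i) z = 'D_v (tau_hat (trans c i)) z.
  exact: (derive_eq_on v oh (@ttrans_tau_hat c i) o).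
have -> : tchart i a = tau_hat (trans c i) z.
  by rewrite -ttrans_tau_hat // /z /trans /= tchartK.
rewrite !E.
have hAc : local_acs (overlap c i) (local_J J c).
  have [oc lc sc mc] := local_J_acs J c.
  split => // [y /overlap_cod|y w /overlap_cod|w k]; [exact: lc|exact: sc|].
  exact (Ck_subset (@overlap_cod _ _ _ c i) (mc w k)).
have mt y : overlap c i y -> cod i (trans c i y).
  by move=> /trans_overlap /overlap_cod.
exact (hat_change hAc (local_J_acs J i) mt (trans_smooth c i)
  (fun y w oy => local_J_trans J w oy) u o).
Qed.

Definition hat_at a (xi : 'rV[R]_(n + n)) : 'rV[R]_(n + n) :=
  hat (local_J J (chart_at a)) (@tchart R n M (chart_at a) a) xi.

Lemma hat_dom_tchart i a : tdom i a -> hat_dom (cod i) (tchart i a).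
Proof. by move=> ai; rewrite /hat_dom /= row_mxKl; exact: dom_cod. Qed.

Lemma hat_at_linear a : linear (hat_at a).
Proof. exact (local_linear (hJ _) (@hat_dom_tchart (chart_at a) a (chart_atP a))). Qed.

Definition hat_lin a : {linear 'rV[R]_(n + n) -> 'rV[R]_(n + n)} :=
  HB.pack (hat_at a) (GRing.isLinear.Build _ _ _ _ _ (hat_at_linear a)).

Lemma hat_linE a xi : hat_lin a xi =
  hat (local_J J (chart_at a)) (@tchart R n M (chart_at a) a) xi.
Proof. by []. Qed.

(** The structure is defined at each point in the preferred chart there, which varies with the
    point; smoothness and the Nijenhuis tensor need the formula in one fixed chart. *)
Lemma dchart_hat_lin i z w : tcod i z ->
  tdchart i (tparam i z) (hat_lin (tparam i z) (tdparam i (tparam i z) w)) =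
  hat (local_J J i) z w.
Proof.
move=> cz; set a : TM := tparam i z; have di : tdom i a by exact: (@cod_dom _ _ TM).
have dc := chart_atP a.
rewrite (@dchart_trans _ _ TM _ _ _ _ dc di) dchart_at hat_linE.
rewrite -(hat_dchart _ dc di) -chart_tchart (@paramK _ _ TM _ _ cz).
rewrite -{1}(@dchart_at _ _ TM a (tdparam i a w)) -(@dchart_trans _ _ TM _ _ _ _ dc di).
by rewrite (@dparamK _ _ TM _ _ _ di).
Qed.

Lemma hat_lin_square a v : hat_lin a (hat_lin a v) = - v.
Proof. exact (local_square (hJ _) v (@hat_dom_tchart (chart_at a) a (chart_atP a))). Qed.

Lemma hat_lin_smooth i w : smooth_on (tcod i) (fun z =>
  tdchart i (tparam i z) (hat_lin (tparam i z) (tdparam i (tparam i z) w))).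
Proof.
move=> k; have oc : open (tcod i) by exact: chart_open.
apply: (Ck_eq oc (f := fun z => hat (local_J J i) z w)).
  by move=> z cz; rewrite dchart_hat_lin.
by rewrite tcod_hat_dom; exact: local_smooth (hJ i) w k.
Qed.

Definition tangent_acs : almost_complex_structure TM :=
  AlmostComplexStructure hat_lin_square hat_lin_smooth.

Lemma local_tangent_acs i z w : tcod i z ->
  @local_J R (n + n) TM tangent_acs i z w = hat (local_J J i) z w.
Proof. exact: dchart_hat_lin. Qed.

Lemma tangent_acs_integrable : integrable tangent_acs <-> integrable J.
Proof.
have oc i : open (tcod i) by exact: chart_open.
have E i z v w : tcod i z ->
    lnij (@local_J R (n + n) TM tangent_acs i) z v w = lnij (hat (local_J J i)) z v w.
  by apply: (lnij_eq _ _ (oc i)) => z' w'; exact: local_tangent_acs.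
split=> [/integrable_charts N0|/integrable_charts N0]; apply/integrable_charts.
  (* The zero vector over [y]; only first halves enter [lsub_lnij_hat], so the arguments are padded
     by 0 as well. *)
  move=> i y v w cy; pose z := row_mx y (0 : 'rV[R]_n).
  have cz : tcod i z by rewrite tcod_hat_dom /hat_dom /= row_mxKl.
  have lz : cod i (lsubmx z) by rewrite row_mxKl.
  have := lsub_lnij_hat (local_J_acs J i) (row_mx v (0 : 'rV[R]_n))
    (row_mx w (0 : 'rV[R]_n)) lz.
  rewrite -(E _ _ _ _ cz) N0 // !row_mxKl => <-.
  by apply/rowP => j; rewrite !mxE.
move=> i z v w cz; rewrite E //; apply: lnij_hat; first exact: local_J_acs.
  by move=> y v' w' cy; exact: N0.
by move: cz; rewrite tcod_hat_dom.
Qed.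

End tangent_structure.

(** Computes a tangent map from a formula for the chart expression that is valid only near the
    point. *)
Lemma diff_on_open {R : realType} {V W : normedModType R} (U : set V)
    (f g : V -> W) x v : open U -> (forall y, U y -> f y = g y) -> U x ->
  differentiable g x -> 'd f x v = 'D_v g x.
Proof.
move=> oU fg Ux dg; rewrite -(derive_eq_on v oU fg Ux) deriveE //.
apply: near_eq_differentiable dg.
by have := open_nbhs_nbhs (conj oU Ux); apply: filterS => y /fg ->.
Qed.

(** * The projection and the zero section *)

Section tangent_maps.
Context {R : realType} {n : nat} {M : manifold R n}.
Variable J : almost_complex_structure M.
Notation TM := (tangent_manifold M).
Notation tcod := (@cod R (n + n) TM).
Notation Jh := (tangent_acs J).
Implicit Types (a : TM) (x : M) (X Y : M -> 'rV[R]_n).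

Definition center x : 'rV[R]_n := chart (chart_at x) x.
Definition tcenter a : 'rV[R]_(n + n) := row_mx (center (base a)) (vec a).

Lemma cod_center x : cod (chart_at x) (center x).
Proof. exact/dom_cod/chart_atP. Qed.

Lemma tchart_at a : @tchart R n M (chart_at (base a)) a = tcenter a.
Proof. by rewrite /tchart dchart_at. Qed.

Lemma tchart_center a : chart (chart_at a) a = tcenter a.
Proof. by rewrite -tchart_at -[chart_at (base a)]chart_at_base. Qed.

Lemma tcod_tcenter a : tcod (chart_at (base a)) (tcenter a).
Proof. by rewrite tcod_hat_dom /hat_dom /= row_mxKl; exact: cod_center. Qed.

Lemma tangent_acsE a xi : Jh a xi = hat (local_J J (chart_at (base a))) (tcenter a) xi.
Proof. by rewrite -tchart_at -[chart_at (base a)]chart_at_base. Qed.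

Lemma lsub_tangent_acs a xi : lsubmx (Jh a xi) = J (base a) (lsubmx xi).
Proof. by rewrite tangent_acsE lsub_hat row_mxKl local_J_at. Qed.

Lemma tangent_map_projection a xi :
  tangent_map (bundle_projection M) a xi = lsubmx xi.
Proof.
rewrite /tangent_map tchart_center.
have oc : open (tcod (chart_at (base a))) by exact: chart_open.
have dl : differentiable (lsubmx : 'rV[R]_(n + n) -> 'rV[R]_n) (tcenter a).
  exact/linear_differentiable/lsubmx_continuous.
have E z : tcod (chart_at (base a)) z ->
    (chart (chart_at (bundle_projection M a)) \o bundle_projection M \o
     @param _ _ TM (chart_at a)) z = lsubmx z.
  rewrite tcod_hat_dom => cz; rewrite /= [@chart_at _ _ TM a]chart_at_base.
  exact: paramK cz.
rewrite (diff_on_open xi oc E (tcod_tcenter a) dl) deriveE //.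
by rewrite diff_lin //; exact: lsubmx_continuous.
Qed.

Lemma projection_pseudoholomorphic : pseudoholomorphic Jh J (bundle_projection M).
Proof.
split; last first.
  by move=> a v; rewrite !tangent_map_projection lsub_tangent_acs.
split.
  by apply/continuousP => A oA; exact: base_preimage_open.
move=> i j k.
have -> : chart i @` (dom i `&` bundle_projection M @^-1` dom j) =
    hat_dom (@overlap R n M i j) by exact: (@toverlapE R n M i j).
have oO := @overlap_open _ _ M i j.
have oh : open (hat_dom (@overlap R n M i j)) by exact: open_lsubmx.
have Cl : Ck k (hat_dom (@overlap R n M i j))
    (fun z : 'rV[R]_(n + n) => lsubmx z : 'rV[R]_n).
  by apply: Ck_lsubmx => //; exact: Ck_id.
exact (Ck_comp oh oO (fun z oz => oz) Cl (@trans_smooth R n M i j k)).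
Qed.

Lemma smooth_row_mx0 k (U : set 'rV[R]_n) : open U ->
  Ck k U (fun y : 'rV[R]_n => row_mx y (0 : 'rV[R]_n)).
Proof. by move=> oU; apply: Ck_row_mx => //; [exact: Ck_id|exact: Ck_cst]. Qed.

Lemma zero_section_continuous : continuous (zero_section M).
Proof.
apply/continuousP => A oA; rewrite openE => x Ax.
set i := chart_at x; have dx : dom i x by exact: chart_atP.
have oQ : open [set z | cod i (lsubmx z) /\ A (tparam i z)] by exact: (oA i).
pose Q := [set y : 'rV[R]_n | cod i y] `&`
  (fun y => row_mx y (0 : 'rV[R]_n)) @^-1`
    [set z | cod i (lsubmx z) /\ A (tparam i z)].
have oc : open (cod i) by exact: chart_open.
have oQ' : open Q.
  apply: open_preimage_on => // y cy.
  exact: (smooth_row_mx0 0 oc) y cy.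
have oN : open (dom i `&` chart i @^-1` Q) by exact: chart_preimage_open.
have zE z : dom i z -> tparam i (row_mx (chart i z) 0) = zero_section M z.
  by move=> dz; rewrite /tparam row_mxKl row_mxKr chartK // (lin0 (dparam_linear i z)).
apply: filterS (open_nbhs_nbhs (conj oN (conj dx _))) => [z [dz [_ /= [_]]]|].
  by rewrite zE.
split; first exact: dom_cod.
by split; [rewrite row_mxKl; exact: dom_cod|rewrite zE].
Qed.

Lemma chart_zero_section i j y : overlap i j y ->
  tchart j (zero_section M (param i y)) = row_mx (trans i j y) 0.
Proof. by move=> _; rewrite /tchart (lin0 (dchart_linear j _)). Qed.

Lemma tangent_map_zero_section x v :
  tangent_map (zero_section M) x v = row_mx v 0.
Proof.
have oc : open (cod (chart_at x)) by exact: chart_open.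
have C1 := smooth_row_mx0 1 oc.
have d0 := C1.1 _ (cod_center x).
have E y : cod (chart_at x) y ->
    (chart (chart_at (zero_section M x)) \o zero_section M \o
     param (chart_at x)) y = row_mx y 0.
  move=> cy; rewrite /= [chart_at (zero_section M x)]chart_at_base /=.
  by rewrite /tchart (lin0 (dchart_linear _ _)) /= paramK.
rewrite /tangent_map (diff_on_open v oc E (cod_center x) d0) derive_row_mx //.
by rewrite derive_id derive_cst.
Qed.

Lemma zero_section_pseudoholomorphic : pseudoholomorphic J Jh (zero_section M).
Proof.
split; last first.
  move=> x v; rewrite !tangent_map_zero_section tangent_acsE /=.
  rewrite /hat /tcenter !row_mxKl !row_mxKr local_J_at; congr row_mx.
  have hJ := local_J_acs J (chart_at x); have cx := cod_center x.
  (* Both corrections are linear in the point of the fibre, so they vanish on the zero section. *)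
  rewrite /hat_vert -/(lnij _ _ _ _) (lin0 (local_linear hJ cx)).
  rewrite (lin0 (dacs_linearl hJ _ cx)) (lin0 (lnij_linearr hJ _ cx)).
  by rewrite (lin0 (local_linear hJ cx)) scaler0 !addr0.
split; first exact: zero_section_continuous.
move=> i j k; have oO := @overlap_open _ _ M i j.
apply: (Ck_eq (f := fun y => row_mx (trans i j y) 0) oO).
  by move=> y oy; rewrite -chart_zero_section.
by apply: Ck_row_mx => //; [exact: trans_smooth|exact: Ck_cst].
Qed.

End tangent_maps.

(** * Agreement with the construction from a minimal connection *)

Section induced.
Context {R : realType} {n : nat} {M : manifold R n}.
Variable J : almost_complex_structure M.
Notation TM := (tangent_manifold M).
Notation Jh := (tangent_acs J).
Implicit Types (a : TM) (x : M) (X Y : M -> 'rV[R]_n).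

Lemma vertical_liftE a u : vertical_lift a u = row_mx 0 u.
Proof.
rewrite /vertical_lift derive1E.
have -> : (fun t : R => chart (chart_at a)
     (TangentVector (base a) (vec a + t *: u) : TM)) =
    fun t : R => tcenter a + t *: row_mx 0 u.
  apply/funext => t; rewrite [chart_at a]chart_at_base.
  transitivity (tchart (chart_at (base a)) (TangentVector (base a) (vec a + t *: u))).
    by [].
  rewrite /tchart /= dchart_at /tcenter scale_row_mx scaler0 add_row_mx addr0.
  by [].
have di : differentiable (id : 'rV[R]_(n + n) -> _) (tcenter a + 0 *: row_mx 0 u) by [].
by have [_ ->] := derive_line di; rewrite derive_id.
Qed.

Lemma tangent_map_field_section Y x w : smooth_field Y ->
  tangent_map (field_section Y) x w =
  row_mx w ('D_w (local_field (chart_at x) Y) (center x)).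
Proof.
move=> sY; set c := chart_at x.
have oc : open (cod c) by exact: chart_open.
have C1 : Ck 1 (cod c) (fun y => row_mx y (local_field c Y y)).
  by apply: Ck_row_mx => //; [exact: Ck_id|exact: sY].
have d0 := C1.1 _ (cod_center x).
have E y : cod c y ->
    (chart (chart_at (field_section Y x)) \o field_section Y \o param c) y =
    row_mx y (local_field c Y y).
  move=> cy; rewrite /= [chart_at (field_section Y x)]chart_at_base /=.
  by rewrite /tchart /= paramK.
rewrite /tangent_map (diff_on_open w oc E (cod_center x) d0) derive_row_mx //.
by rewrite derive_id.
Qed.

(** The premises are the torsion conditions for (JX, Y) and (X, Y): [e] is the covariant derivative
    of X along Y; [q], [r], [p] are the coordinate derivatives of Y along X, of X along Y, of Y
    along JX; and [d] is (D_Y A) X. The two quarters of [A N] add up to the half. *)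
Lemma hat_vert_induced (A : 'rV[R]_n -> 'rV[R]_n) (e q r d p N DJXY DXY : 'rV[R]_n) :
  linear A ->
  DJXY - A e - (p - (d + A r)) = 4^-1 *: (- A N) ->
  DXY - e - (q - r) = 4^-1 *: N ->
  A (q - DXY) + d + 2^-1 *: A N = p - DJXY.
Proof.
move=> lA /eqP; rewrite !subr_eq => /eqP -> /eqP; rewrite !subr_eq => /eqP ->.
rewrite !(linD lA, linN lA, linZ lA).
by apply/rowP => j; rewrite !mxE; field.
Qed.

(** Minimality enters three times: the torsion at (X, Y), the torsion at (JX, Y), where the
    Nijenhuis tensor becomes - J N(X, Y), and nabla J = 0, which moves J out of the derivative of JX
    along Y. *)
Lemma tangent_acs_horizontal D X Y x : minimal_connection J D ->
  smooth_field X -> smooth_field Y ->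
  let c := chart_at x in
  hat (local_J J c) (row_mx (center x) (Y x))
    (row_mx (X x) ('D_(X x) (local_field c Y) (center x) - D X Y x)) =
  row_mx (J x (X x))
    ('D_(J x (X x)) (local_field c Y) (center x) - D (acs_field J X) Y x).
Proof.
move=> [cD tD] sX sY c; have sJX := smooth_acs_field J sX.
have cx := cod_center x; have hJ := local_J_acs J c; have dx := chart_atP x.
have lc : local_J J c (center x) =1 J x by move=> w; exact: local_J_at.
rewrite /hat !row_mxKl !row_mxKr lc; congr row_mx.
have Xc : local_field c X (center x) = X x by exact: local_field_at.
have Yc : local_field c Y (center x) = Y x by exact: local_field_at.
have JXc : local_field c (acs_field J X) (center x) = J x (X x).
  exact: local_field_at.
have N1 : nijenhuis J X Y x = lnij (local_J J c) (center x) (X x) (Y x).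
  by rewrite -(dchart_at x (nijenhuis J X Y x)) (nijenhuis_chart J sX sY dx) Xc Yc.
have N2 : nijenhuis J (acs_field J X) Y x = - local_J J c (center x) (nijenhuis J X Y x).
  rewrite N1 -(lnijA hJ _ _ cx).
  rewrite -(dchart_at x (nijenhuis J _ Y x)) (nijenhuis_chart J sJX sY dx) JXc Yc.
  by rewrite lc.
have T1 := tD _ _ sX sY x; have T2 := tD _ _ sJX sY x.
rewrite /torsion lie_bracket_at chart_bracketE -/c -/(center x) Xc Yc in T1.
rewrite /torsion lie_bracket_at chart_bracketE -/c -/(center x) JXc Yc in T2.
rewrite (derive_acs_field J _ sX cx) Xc (cD _ _ sY sX) -(lc (D Y X x)) N2 in T2.
rewrite /hat_vert -/(lnij _ _ _ _) -N1.
exact (hat_vert_induced (local_linear hJ cx) T2 T1).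
Qed.

Lemma tangent_acs_induced (D : @linear_connection R n M) :
  minimal_connection J D -> induced_structure J D Jh.
Proof.
move=> mD a; split.
- move=> xi.
  have [X sX Xx] := field_through (base a) (lsubmx xi).
  have [Y sY Yx] := field_through (base a) (vec a).
  pose h := tangent_map (field_section Y) (base a) (X (base a))
         - vertical_lift a (D X Y (base a)).
  (* The horizontal vector [h] has the same first half as [xi], so the difference is vertical. *)
  exists h, (xi - h); split.
  + by exists X, Y.
  + exists (rsubmx (xi - h)) => //; rewrite vertical_liftE -[RHS]hsubmxK.
    congr row_mx; rewrite /h lsubD lsubN lsubD lsubN.
    rewrite (tangent_map_field_section _ _ sY) vertical_liftE !row_mxKl Xx.
    by rewrite subr0 subrr.
  + by rewrite addrC subrK.
- move=> h [X [Y [sX sY Yx hE]]].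
  split; last by rewrite !tangent_map_projection lsub_tangent_acs.
  have sJX := smooth_acs_field J sX.
  exists (acs_field J X), Y; split; [exact: sJX|exact: sY|exact: Yx|].
  rewrite hE !(tangent_map_field_section _ _ sY) !vertical_liftE.
  rewrite !opp_row_mx !add_row_mx !oppr0 !addr0 tangent_acsE /tcenter -Yx.
  exact: tangent_acs_horizontal.
- move=> u; rewrite !vertical_liftE tangent_acsE /hat /tcenter !row_mxKl !row_mxKr.
  have hJ := local_J_acs J (chart_at (base a)); have cx := cod_center (base a).
  rewrite local_J_at linear0; congr row_mx.
  (* A vertical vector has w = 0, and both corrections are linear in w. *)
  rewrite /hat_vert -/(lnij _ _ _ _) local_J_at (lin0 (dacs_linearr hJ _ cx)).
  by rewrite (lin0 (lnij_linearl hJ _ cx)) (lin0 (local_linear hJ cx)) scaler0 !addr0.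
Qed.

End induced.

(** The existence clause ensures that the clause over all minimal connections is not vacuous; a
    single [Jh] serving for all of them expresses independence of the choice. *)
Theorem theorem1 (R : realType) (n : nat) (M : manifold R n)
    (J : almost_complex_structure M) :
  exists Jh : almost_complex_structure (tangent_manifold M),
    [/\ exists D : linear_connection, minimal_connection J D,
        forall D : linear_connection,
          minimal_connection J D -> induced_structure J D Jh,
        pseudoholomorphic Jh J (bundle_projection M),
        pseudoholomorphic J Jh (zero_section M)
      & integrable Jh <-> integrable J].
Proof.
exists (tangent_acs J); split.
- have [D tD] := @torsion_free_exists R n M.
  exact: minimal_connection_of tD.
- by move=> D; exact: tangent_acs_induced.
- exact: projection_pseudoholomorphic.
- exact: zero_section_pseudoholomorphic.
- exact: tangent_acs_integrable.
Qed.
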